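(* The forward phase of Gaussian elimination without pivoting applied to a system of $\sqrt{n}-1$ linear equations in $\sqrt{n}-1$ unknowns can be performed in the $(m,\ell)$-TCU model in time $$T(n)=\Theta\!\left(\frac{n^{3/2}}{m^{1/2}}+\frac{n}{m}\ell+n\sqrt{m}\right).$$ In particular, when $\sqrt{n}\geq m$ this is $\Theta\!\left(\frac{n^{3/2}}{m^{1/2}}+\frac{n}{m}\ell\right)$.
   Context: The system is represented by a $\sqrt{n}\times\sqrt{n}$ matrix $c$ whose $i$-th row ($1\le i<\sqrt{n}$) is $(a_{i,1},\dots,a_{i,\sqrt{n}-1},b_i)$, encoding $a_{i,1}x_1+\dots+a_{i,\sqrt{n}-1}x_{\sqrt{n}-1}=b_i$, and whose last row is zero. The forward phase is the computation: for $k=1,\dots,\sqrt{n}-2$, for $i=k+1,\dots,\sqrt{n}-1$, for $j=k+1,\dots,\sqrt{n}$, set $c[i,j]\leftarrow c[i,j]-\frac{c[i,k]}{c[k,k]}\,c[k,j]$ (pivots assumed nonzero); its output is the resulting matrix. The paper's algorithm assumes $m$ divides $n$. The $(m,\ell)$-TCU model (parameters $m\ge 1$, $\ell\ge 0$) is the standard RAM model whose CPU additionally contains a tensor unit: by a constant-size instruction specifying the memory addresses of the operands and of the output, the unit multiplies an $N\times\sqrt{m}$ matrix by a $\sqrt{m}\times\sqrt{m}$ matrix (where $N\geq\sqrt{m}$ is chosen by the algorithm) and writes the product to memory, at a cost of $O(N\sqrt{m}+\ell)$ time. The running time of an algorithm is the total cost of all operations performed, including all calls to the tensor unit. *)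

(* Defs.v *)
From HB Require Import structures.
From mathcomp Require Import all_boot all_order all_algebra.

Set Implicit Arguments.
Unset Strict Implicit.
Unset Printing Implicit Defensive.

Import Order.TTheory GRing.Theory Num.Theory.
Local Open Scope ring_scope.

Section ForwardPhase.
Variables (F : fieldType) (q : nat).
Implicit Types (c : 'M[F]_q) (k i j : 'I_q).

(* Row [q - 1] (the last one, indices start at 0) carries no equation. *)
Definition is_system c := forall i j, i.+1 = q -> c i j = 0.

Definition ge_update k i c j : 'M[F]_q :=
  \matrix_(x, y) if (x == i) && (y == j) then c i j - c i k / c k k * c k j
                 else c x y.

Definition ge_row k c i : 'M[F]_q :=
  foldl (ge_update k i) c [seq j : 'I_q <- enum 'I_q | (k < j)%N].

Definition ge_step c k : 'M[F]_q :=
  foldl (ge_row k) c [seq i : 'I_q <- enum 'I_q | (k < i)%N && (i.+1 < q)%N].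

(* The matrix after the iterations [0, ..., h - 1] of the outermost loop, whose
   index ranges over [0 <= k <= q - 3] (that is, [1 <= k <= q - 2] when counted
   from 1). *)
Definition ge_steps h c : 'M[F]_q :=
  foldl ge_step c [seq k : 'I_q <- enum 'I_q | (k.+2 < q)%N && (k < h)%N].

Definition forward_phase c : 'M[F]_q := ge_steps q c.

(* The divisors met by the computation: entry [(k, k)] when iteration [k]
   starts. *)
Definition pivots_nonzero c :=
  forall k, (k.+2 < q)%N -> ge_steps k c k k != 0.

End ForwardPhase.

(* A RAM over two sorts of words: natural numbers, used for addresses and
   control, and elements of a field. Each sort has registers, which
   instructions name directly, and a memory, which is only reached through an
   address held in an integer register. There is no unit-cost multiplication of
   the unbounded integers: it would make the machine unrealistically strong. *)
Inductive instr : Type :=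
  | ISet (r k : nat)
  | IAdd (r a b : nat)
  | ISub (r a b : nat)
  | ILoad (r a : nat)
  | IStore (a r : nat)
  | FSet (r k : nat)
  | FAdd (r a b : nat)
  | FSub (r a b : nat)
  | FMul (r a b : nat)
  | FDiv (r a b : nat)
  | FLoad (r a : nat)
  | FStore (a r : nat)
  | Jump (l : nat)
  | IJumpZ (r l : nat)
  | FJumpZ (r l : nat)
  | Tensor (a b d h : nat)
  | Halt.

Definition program := seq instr.

Record state (F : fieldType) := State {
  pc : nat;
  ireg : nat -> nat;
  imem : nat -> nat;
  freg : nat -> F;
  fmem : nat -> F
}.

Definition upd (T : Type) (f : nat -> T) (x : nat) (v : T) : nat -> T :=
  fun y => if y == x then v else f y.

(* Matrices are stored contiguously in row-major order. *)
Definition read_mx (F : fieldType) (f : nat -> F) (a N p : nat) : 'M[F]_(N, p) :=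
  \matrix_(i, j) f (a + i * p + j)%N.

Definition write_mx (F : fieldType) (f : nat -> F) (a N p : nat)
    (A : 'M[F]_(N, p)) : nat -> F :=
  fun x => if [pick ij : 'I_N * 'I_p | x == (a + ij.1 * p + ij.2)%N] is Some ij
           then A ij.1 ij.2 else f x.

(* The effect of one instruction on a machine whose tensor unit multiplies by
   [p * p] matrices; [None] is a fault, except for [Halt]. For
   [Tensor a b d h] the integer registers [a], [b] and [d] hold the addresses of
   the two operands and of the output, and [h] holds the number of rows of the
   first operand. *)
Definition step (F : fieldType) (p : nat) (i : instr) (s : state F) :
    option (state F) :=
  let: State c ir im fr fm := s in
  let seti r v := Some (State c.+1 (upd ir r v) im fr fm) in
  let setf r v := Some (State c.+1 ir im (upd fr r v) fm) in
  let goto l := Some (State l ir im fr fm) in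
  match i with
  | ISet r k => seti r k
  | IAdd r a b => seti r (ir a + ir b)%N
  | ISub r a b => seti r (ir a - ir b)%N
  | ILoad r a => seti r (im (ir a))
  | IStore a r => Some (State c.+1 ir (upd im (ir a) (ir r)) fr fm)
  | FSet r k => setf r k%:R
  | FAdd r a b => setf r (fr a + fr b)
  | FSub r a b => setf r (fr a - fr b)
  | FMul r a b => setf r (fr a * fr b)
  | FDiv r a b => if fr b == 0 then None else setf r (fr a / fr b)
  | FLoad r a => setf r (fm (ir a))
  | FStore a r => Some (State c.+1 ir im fr (upd fm (ir a) (fr r)))
  | Jump l => goto l
  | IJumpZ r l => goto (if ir r == 0%N then l else c.+1)
  | FJumpZ r l => goto (if fr r == 0 then l else c.+1)
  | Tensor a b d h =>
      if (p <= ir h)%N then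
        Some (State c.+1 ir im fr
          (write_mx fm (ir d)
             (read_mx fm (ir a) (ir h) p *m read_mx fm (ir b) p p)))
      else None
  | Halt => None
  end.

Definition cost (R : rcfType) (F : fieldType) (p : nat) (l : R) (i : instr)
    (s : state F) : R :=
  if i is Tensor _ _ _ h then (ireg s h * p)%:R + l else 1.

(* [run P p l s t s'] : from [s], [P] reaches a [Halt] instruction in state [s']
   without fault and in total time [t]. *)
Inductive run (R : rcfType) (F : fieldType) (P : program) (p : nat) (l : R) :
    state F -> R -> state F -> Prop :=
  | run_halt s : onth P (pc s) = Some Halt -> run P p l s 1 s
  | run_step s i s1 t s2 :
      onth P (pc s) = Some i -> step p i s = Some s1 -> run P p l s1 t s2 ->
      run P p l s (cost p l i s + t) s2.

(* The program is given the side of the input matrix and that of the tensor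
   unit in integer registers 0 and 1, and the input matrix at address 0. *)
Definition initial (F : fieldType) (q p : nat) (c : 'M[F]_q) : state F :=
  State 0 (fun r => nth 0 [:: q; p] r)%N (fun _ => 0%N) (fun _ => 0)
    (write_mx (fun _ => 0) 0 c).

Definition performs_forward_phase (R : rcfType) (F : fieldType) (P : program)
    (q p : nat) (l : R) (c : 'M[F]_q) (t : R) : Prop :=
  exists2 s : state F, run P p l (initial p c) t s &
    read_mx (fmem s) 0 q q = forward_phase c.

(* Main.v *)
Require Import Defs.
From HB Require Import structures.
From mathcomp Require Import all_boot all_order all_algebra.
From mathcomp Require Import zify ring lra.

Set Implicit Arguments.
Unset Strict Implicit.
Unset Printing Implicit Defensive.

Import Order.TTheory GRing.Theory Num.Theory.

(* Write [V h i j] for entry [(i, j)] after [h] elimination steps, so that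
   [V (k + 1) i j = V k i j - V k i k / V k k k * V k k j] for [k < min i j], and
   [V] no longer changes once [h >= min i j]. Summing this over a block
   [lo <= k < lo + p] turns the update of the entries with [min i j >= lo + p]
   into the product of a [q * p] matrix of multipliers by the rows
   [lo, ..., lo + p - 1]. For each of the [q / p] blocks the program first
   eliminates within the entries with [min i j < lo + p], which takes time
   [O (q p^2)], and then updates the rest by [q / p] tensor calls of [q] rows.
   Both branches of every conditional take the same time and every loop runs over
   its full range, so the running time is a function of [q], [p] and the latency
   alone, of the announced order. *)

(** * Structured programs *)

(** The lower bound is claimed with a single constant for every admissible input, so a program that
    skipped idle work would need its own analysis of how little it can do. With a time independent
    of the entries, both bounds become estimates of one expression in [q], [p] and [N = q / p]: the
    [N ^ 2] tensor calls, of cost [q * p + l] each, give [n^(3/2) / m^(1/2)] and [(n / m) l], and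
    the [N] panels, of cost about [q * p ^ 2] each, give [n sqrt m]. The product may be formed after
    the panel because row [k] and column [k] are final after [k] steps: multipliers and pivot rows
    read at the end of a block are the ones step [k] itself would use. The loops let [k] run over
    all of [0, ..., q - 1], beyond the range of the pivots, while the machine faults on a division
    by zero; the code therefore imitates the convention that the inverse of 0 is 0, which keeps it
    in agreement with the field expressions of the invariants. *)

Inductive test : Type := TI (r : nat) | TF (r : nat).

Inductive cmd : Type :=
  | Instr (i : instr)
  | Seq (c1 c2 : cmd)
  | While (b : test) (c : cmd)
  | If (b : test) (c1 c2 : cmd).

Definition jump_zero (b : test) (l : nat) : instr :=
  match b with TI r => IJumpZ r l | TF r => FJumpZ r l end.

Fixpoint csize (c : cmd) : nat :=
  match c with
  | Instr _ => 1
  | Seq c1 c2 => csize c1 + csize c2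
  | While _ c => (csize c).+2
  | If _ c1 c2 => (csize c1 + csize c2).+3
  end.

(* The final jump of the first branch of a conditional only serves to make both
   branches cost the same overhead. *)
Fixpoint compile (o : nat) (c : cmd) : program :=
  match c with
  | Instr i => [:: i]
  | Seq c1 c2 => compile o c1 ++ compile (o + csize c1) c2
  | While b c =>
      jump_zero b (o + csize c).+2 :: rcons (compile o.+1 c) (Jump o)
  | If b c1 c2 =>
      jump_zero b (o + csize c2).+2
      :: (compile o.+1 c2 ++ [:: Jump (o + csize c1 + csize c2).+3])
      ++ rcons (compile (o + csize c2).+2 c1)
               (Jump (o + csize c1 + csize c2).+3)
  end.

Lemma size_compile o c : size (compile o c) = csize c.
Proof.
elim: c o => [i|c1 IH1 c2 IH2|b c IH|b c1 IH1 c2 IH2] o //=.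
- by rewrite size_cat IH1 IH2.
- by rewrite size_rcons IH.
- by rewrite !size_cat /= size_rcons IH1 IH2; lia.
Qed.

Definition simple (i : instr) : bool :=
  match i with
  | Jump _ | IJumpZ _ _ | FJumpZ _ _ | Halt => false
  | _ => true
  end.

(** * Big-step semantics of structured programs and correctness of their compilation *)

Section Exec.
Variables (F : fieldType) (p : nat).
Implicit Types (s : state F) (c : cmd).

Definition zero_test (b : test) s : bool :=
  match b with TI r => ireg s r == 0 | TF r => freg s r == 0%R end.

Definition unit_time (i : instr) s : nat :=
  if i is Tensor _ _ _ h then ireg s h * p else 1.

Definition tensor_calls (i : instr) : nat :=
  if i is Tensor _ _ _ _ then 1 else 0.

(* [exec c s t k s'] : [c] leads from [s] to [s'] with [k] calls to the tensor
   unit, in time [t] apart from the latency of these calls. Program counters are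
   irrelevant here. *)
Inductive exec : cmd -> state F -> nat -> nat -> state F -> Prop :=
  | exec_instr i s s' : simple i -> step p i s = Some s' ->
      exec (Instr i) s (unit_time i s) (tensor_calls i) s'
  | exec_seq c1 c2 s t1 k1 s1 t2 k2 s2 :
      exec c1 s t1 k1 s1 -> exec c2 s1 t2 k2 s2 ->
      exec (Seq c1 c2) s (t1 + t2) (k1 + k2) s2
  | exec_while_end b c s : zero_test b s -> exec (While b c) s 1 0 s
  | exec_while_loop b c s t1 k1 s1 t2 k2 s2 : ~~ zero_test b s ->
      exec c s t1 k1 s1 -> exec (While b c) s1 t2 k2 s2 ->
      exec (While b c) s (t1 + t2).+2 (k1 + k2) s2
  | exec_if b c1 c2 s t k s1 :
      exec (if zero_test b s then c1 else c2) s t k s1 ->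
      exec (If b c1 c2) s t.+2 k s1.

Definition set_pc o s : state F :=
  State o (ireg s) (imem s) (freg s) (fmem s).

Lemma step_set_pc i s s' o : simple i -> step p i s = Some s' ->
  step p i (set_pc o s) = Some (set_pc o.+1 s').
Proof.
case: s => pc ir im fr fm; case: i => //=;
  try by move=> *; match goal with H : Some _ = Some _ |- _ => case: H => <- end.
- by move=> r a b _; case: ifP => // _ [<-].
- by move=> a b d h _; case: ifP => // _ [<-].
Qed.

Lemma step_jump_zero b l o s :
  step p (jump_zero b l) (set_pc o s)
  = Some (set_pc (if zero_test b s then l else o.+1) s).
Proof. by case: b. Qed.

Definition code_at (P : program) o (Q : program) :=
  exists P1 P2, P = P1 ++ Q ++ P2 /\ size P1 = o.

Lemma code_at_catl P o Q1 Q2 : code_at P o (Q1 ++ Q2) -> code_at P o Q1.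
Proof. by case=> P1 [P2 [-> <-]]; exists P1, (Q2 ++ P2); rewrite !catA. Qed.

Lemma code_at_catr P o Q1 Q2 :
  code_at P o (Q1 ++ Q2) -> code_at P (o + size Q1) Q2.
Proof.
by case=> P1 [P2 [-> <-]]; exists (P1 ++ Q1), P2; rewrite size_cat !catA.
Qed.

Lemma code_at_onth P o i Q : code_at P o (i :: Q) -> onth P o = Some i.
Proof. by case=> P1 [P2 [-> <-]]; rewrite onth_cat ltnn subnn. Qed.

Lemma code_at_behead P o i Q : code_at P o (i :: Q) -> code_at P o.+1 Q.
Proof. by rewrite -cat1s => /code_at_catr; rewrite addn1. Qed.

Section Run.
Variables (R : rcfType) (l : R) (P : program).
Local Open Scope ring_scope.

Definition total_time (t k : nat) : R := t%:R + k%:R * l.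

Lemma cost_total_time i s :
  cost p l i s = total_time (unit_time i s) (tensor_calls i).
Proof.
by case: i => *; rewrite /total_time /= ?mul0r ?addr0 ?mul1r.
Qed.

Lemma total_timeD t1 k1 t2 k2 :
  total_time (t1 + t2) (k1 + k2) = total_time t1 k1 + total_time t2 k2.
Proof. by rewrite /total_time !natrD mulrDl addrACA. Qed.

Lemma total_timeS t k : total_time t.+1 k = 1 + total_time t k.
Proof. by rewrite /total_time -addn1 natrD; ring. Qed.

Lemma run_jump_zero b a o s t s' : onth P o = Some (jump_zero b a) ->
  run P p l (set_pc (if zero_test b s then a else o.+1) s) t s' ->
  run P p l (set_pc o s) (1 + t) s'.
Proof.
move=> Po Hr; have -> : 1 = cost p l (jump_zero b a) (set_pc o s) by case: b {Po Hr}.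
by apply: (run_step (s := set_pc o s) Po _ Hr); rewrite step_jump_zero.
Qed.

Lemma run_jump a o s t s' : onth P o = Some (Jump a) ->
  run P p l (set_pc a s) t s' -> run P p l (set_pc o s) (1 + t) s'.
Proof.
by move=> Po Hr; apply: (run_step (s := set_pc o s) (i := Jump a) Po _ Hr).
Qed.

(** A fragment does not end in [Halt], whereas [run] only describes complete runs. The fragment is
    therefore prepended to an arbitrary run of what follows it, a form that composes along the
    induction. *)
Lemma exec_run c s t k s1 : exec c s t k s1 -> forall o t2 s2,
  code_at P o (compile o c) ->
  run P p l (set_pc (o + csize c) s1) t2 s2 ->
  run P p l (set_pc o s) (total_time t k + t2) s2.
Proof.
elim=> {c s t k s1}.
- move=> i s s' si Hs o t2 s2 /code_at_onth Po /=; rewrite addn1 => Hr.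
  rewrite -(_ : cost p l i (set_pc o s) = total_time (unit_time i s) (tensor_calls i));
    last by rewrite cost_total_time; case: (i).
  by apply: (run_step (s := set_pc o s) Po _ Hr); apply: step_set_pc.
- move=> c1 c2 s t1 k1 s1 t2 k2 s2 _ IH1 _ IH2 o t3 s3 /= HP Hr.
  rewrite total_timeD -addrA; apply: IH1; first exact: code_at_catl HP.
  apply: IH2; last by rewrite -addnA.
  by move/code_at_catr: HP; rewrite size_compile.
- move=> b c s bs o t2 s2 /= /code_at_onth Po.
  rewrite total_timeS /total_time mul0r !addr0 => Hr.
  by apply: (run_jump_zero Po); rewrite bs -!addnS.
- move=> b c s t1 k1 s1 t2 k2 s2 bs _ IH1 _ IH2 o t3 s3 HP Hr.
  have /= Po := code_at_onth HP; have := HP => /=.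
  move=> /code_at_behead; rewrite -cats1 => HP1.
  have /code_at_onth := code_at_catr HP1; rewrite size_compile => Pj.
  rewrite 2!total_timeS total_timeD.
  set T1 := total_time t1 k1; set T2 := total_time t2 k2.
  have -> : 1 + (1 + (T1 + T2)) + t3 = 1 + (T1 + (1 + (T2 + t3))) by ring.
  apply: (run_jump_zero Po); rewrite (negbTE bs).
  apply: IH1; first exact: code_at_catl HP1.
  by apply: run_jump Pj _; apply: IH2.
- move=> b c1 c2 s t k s1 _ IH o t2 s2 HP Hr.
  have /= Po := code_at_onth HP; have := HP => /=.
  move=> /code_at_behead HP1; have HP2 := code_at_catl HP1.
  move: HP1 => /code_at_catr; rewrite size_cat size_compile /= addn1 -cats1.
  rewrite addSnnS !addnS => HP3.
  rewrite 2!total_timeS -2!addrA; apply: (run_jump_zero Po).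
  rewrite addrCA; case: ifP IH => bs IH.
    apply: IH; first exact: code_at_catl HP3.
    have /code_at_onth := code_at_catr HP3; rewrite size_compile => Pj.
    by apply: run_jump Pj _; move: Hr; rewrite /= !addnS addnA.
  apply: IH; first exact: code_at_catl HP2.
  have /code_at_onth := code_at_catr HP2; rewrite size_compile => Pj.
  by apply: run_jump Pj _; move: Hr; rewrite /= !addnS addnA.
Qed.

End Run.

End Exec.

Definition written (i : instr) : seq nat :=
  match i with
  | ISet r _ | IAdd r _ _ | ISub r _ _ | ILoad r _ => [:: r]
  | _ => [::]
  end.

Fixpoint modified (c : cmd) : seq nat :=
  match c with
  | Instr i => written i
  | Seq c1 c2 | If _ c1 c2 => modified c1 ++ modified c2
  | While _ c => modified c
  end.

Fixpoint keeps_imem (c : cmd) : bool :=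
  match c with
  | Instr i => if i is IStore _ _ then false else true
  | Seq c1 c2 | If _ c1 c2 => keeps_imem c1 && keeps_imem c2
  | While _ c => keeps_imem c
  end.

(* Only meaningful for the commands that are [straight]. *)
Fixpoint static_time (c : cmd) : nat :=
  match c with
  | Instr _ => 1
  | Seq c1 c2 => static_time c1 + static_time c2
  | While _ c => 0
  | If _ c1 _ => (static_time c1).+2
  end.

Fixpoint straight (c : cmd) : bool :=
  match c with
  | Instr i => simple i && (tensor_calls i == 0)
  | Seq c1 c2 => straight c1 && straight c2
  | While _ _ => false
  | If _ c1 c2 =>
      [&& straight c1, straight c2 & static_time c1 == static_time c2]
  end.

(* Register 3 holds the distance to the upper bound of the innermost active
   loop, recomputed just before each test; register 22 is never written, hence
   holds 0. *)
Definition For (i lo hi d : nat) (c : cmd) : cmd :=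
  Seq (Instr (IAdd i lo 22)) (Seq (Instr (ISub 3 hi i))
    (While (TI 3) (Seq c (Seq (Instr (IAdd i i d)) (Instr (ISub 3 hi i)))))).

(** The 3 counts the two initial instructions and the final test; each iteration adds 4, for its
    test, the increment, the new distance and the jump back. *)
Definition for_time (N t : nat) : nat := 3 + N * (t + 4).

(** * Proof rules for straight-line code and for loops *)

Section Rules.
Variables (F : fieldType) (p : nat).
Implicit Types (s : state F) (c : cmd).

Lemma exec_frame c s t k s' : exec p c s t k s' ->
  {in [predC modified c], ireg s' =1 ireg s}
  /\ (keeps_imem c -> imem s' = imem s).
Proof.
elim=> {c s t k s'}.
- move=> i [pc ir im fr fm] s' _; case: i => //=;
    try by move=> *; match goal with H : Some _ = Some _ |- _ =>
      case: H => <-; split=> // x; rewrite !inE /= /upd => /negbTE-> end.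
  + by move=> r a b; case: ifP => // _ [<-].
  + by move=> a b d h; case: ifP => // _ [<-].
- move=> c1 c2 s t1 k1 s1 t2 k2 s2 _ [f1 m1] _ [f2 m2]; split=> /=.
    move=> r; rewrite !inE mem_cat => /norP[r1 r2].
    by rewrite f2 ?inE // f1 ?inE.
  by case/andP=> /m1 <- /m2.
- by [].
- move=> b c s t1 k1 s1 t2 k2 s2 _ _ [f1 m1] _ [f2 m2]; split=> /=.
    by move=> r rc; rewrite f2 // f1.
  by move=> cm; rewrite m2 // m1.
- move=> b c1 c2 s t k s1 _ [f m]; split=> /=.
    move=> r; rewrite !inE mem_cat => /norP[r1 r2]; apply: f.
    by rewrite inE; case: ifP.
  by case/andP=> m1 m2; apply: m; case: ifP.
Qed.

(** Loop-free code is run by computation on a symbolic state, so that the final state of a loop body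
    is found by reduction and [reflexivity]. *)
Fixpoint eval c s : option (state F) :=
  match c with
  | Instr i => step p i s
  | Seq c1 c2 => if eval c1 s is Some s1 then eval c2 s1 else None
  | While _ _ => None
  | If b c1 c2 => if zero_test b s then eval c1 s else eval c2 s
  end.

Lemma eval_exec c s s' : straight c -> eval c s = Some s' ->
  exec p c s (static_time c) 0 s'.
Proof.
elim: c s s' => [i|c1 IH1 c2 IH2|//|b c1 IH1 c2 IH2] s s' /=.
- case/andP=> si /eqP ti /(exec_instr si); rewrite ti.
  by have -> : unit_time p i s = 1 by case: i ti {si}.
- case/andP=> st1 st2; case E: (eval c1 s) => [s1|//] E2.
  by rewrite -[0]/(0 + 0); apply: exec_seq (IH1 _ _ st1 E) (IH2 _ _ st2 E2).
- case/and3P=> st1 st2 /eqP tE E; apply: exec_if.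
  by case: ifP E => _ E; [apply: IH1 | rewrite tE; apply: IH2].
Qed.

(** Between two rounds the loop control writes registers [i] and 3, hence the demand that [Q]
    survive changes to these. The upper bound is exactly [N] steps away, so the truncated distance
    vanishes after round [N] and not before. *)
Lemma for_rule i lo hi d c a N e t k s0 (Q : nat -> state F -> Prop) :
  [&& i \notin modified c, hi \notin modified c, d \notin modified c,
      i != hi, i != d, i != 3, hi != 3 & d != 3] ->
  ireg s0 lo = a -> ireg s0 hi = a + N * e -> ireg s0 d = e -> 0 < e ->
  ireg s0 22 = 0 ->
  (forall x s s', Q x s -> imem s' = imem s -> fmem s' = fmem s ->
     {in [predC [:: i; 3]], ireg s' =1 ireg s} -> Q x s') ->
  Q 0 s0 ->
  (forall x s, x < N -> ireg s i = a + x * e ->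
     {in [predC [:: i, 3 & modified c]], ireg s =1 ireg s0} ->
     (keeps_imem c -> imem s = imem s0) ->
     Q x s -> exists2 s', exec p c s t k s' & Q x.+1 s') ->
  exists2 s', exec p (For i lo hi d c) s0 (for_time N t) (N * k) s' & Q N s'.
Proof.
move=> /and5P[ic hic dc ihi /and4P[id_ i3 hi3 d3]] s0lo s0hi s0d e_gt0 s0z Qst Q0 body.
pose Inv x s := [/\ ireg s i = a + x * e, ireg s 3 = a + N * e - (a + x * e),
  {in [predC [:: i, 3 & modified c]], ireg s =1 ireg s0},
  (keeps_imem c -> imem s = imem s0) & Q x s].
have inD (r : nat) : r \notin modified c -> i != r -> r != 3 ->
    r \in [predC [:: i, 3 & modified c]].
  by move=> rc ir r3; rewrite !inE !negb_or eq_sym ir r3.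
(* Induction on the number [x] of rounds still to come. *)
have loop x s : x <= N -> Inv (N - x) s ->
  exists2 s', exec p (While (TI 3) (Seq c (Seq (Instr (IAdd i i d))
     (Instr (ISub 3 hi i))))) s (1 + x * (t + 4)) (x * k) s' & Q N s'.
  elim: x s => [|x IHx] s xN [si s3 fr im Qs].
    exists s; last by rewrite subn0 in Qs.
    by apply: exec_while_end; rewrite /= s3 subn0 subnn.
  have lt_xN : N - x.+1 < N by lia.
  have [s1 c_s1 Q1] := body _ _ lt_xN si fr im Qs.
  have [fr1 im1] := exec_frame c_s1.
  have si1 : ireg s1 i = a + (N - x.+1) * e by rewrite fr1 ?inE.
  have frame r : r \in [predC [:: i, 3 & modified c]] -> ireg s1 r = ireg s0 r.
    move=> rD; have := rD; rewrite !inE !negb_or => /and3P[_ _ rc].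
    by rewrite fr1 ?inE // fr.
  have sd1 : ireg s1 d = e by rewrite frame ?inD.
  have shi1 : ireg s1 hi = a + N * e by rewrite frame ?inD.
  case: s1 => pc1 ir1 im1' fr1' fm1 in c_s1 Q1 fr1 im1 si1 frame sd1 shi1 *.
  rewrite /= in fr1 im1 si1 frame sd1 shi1.
  have Nx : (N - x.+1).+1 = N - x by lia.
  have ir1i : ir1 i + ir1 d = a + (N - x) * e by rewrite si1 sd1 -Nx mulSn; lia.
  pose ir2 := upd ir1 i (ir1 i + ir1 d).
  pose ir3 := upd ir2 3 (ir2 hi - ir2 i).
  have ir3i : ir3 i = a + (N - x) * e.
    by rewrite /ir3 /ir2 /upd (negbTE i3) eqxx ir1i.
  have ir33 : ir3 3 = a + N * e - (a + (N - x) * e).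
    by rewrite /ir3 /ir2 /upd /= eqxx eq_sym (negbTE ihi) shi1 ir1i.
  have ir3F r : r \in [predC [:: i; 3]] -> ir3 r = ir1 r.
    by rewrite !inE negb_or /ir3 /ir2 /upd => /andP[/negbTE-> /negbTE->].
  have [||s2 w_s2 Q2] := IHx (State pc1.+2 ir3 im1' fr1' fm1); first by lia.
    split=> //=.
    + move=> r rD; rewrite ir3F ?frame //.
      by move: rD; rewrite !inE !negb_or => /and3P[-> ->].
    + by move=> kc; rewrite im1 // im.
    + by rewrite -Nx; apply: Qst Q1 _ _ _.
  exists s2 => //.
  have -> : 1 + x.+1 * (t + 4) = ((t + (1 + 1)) + (1 + x * (t + 4))).+2 by lia.
  have -> : x.+1 * k = (k + (0 + 0)) + x * k by lia.
  apply: exec_while_loop w_s2.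
    rewrite /= s3 -lt0n subn_gt0 ltn_add2l ltn_mul2r e_gt0; lia.
  apply: exec_seq c_s1 _; apply: exec_seq; exact: (exec_instr (p := p)).
case: s0 => pc0 ir0 im0 fr0 fm0 in s0lo s0hi s0d s0z Q0 body @Inv loop *.
rewrite /= in s0lo s0hi s0d s0z.
pose ir1 := upd ir0 i (ir0 lo + ir0 22).
pose ir2 := upd ir1 3 (ir1 hi - ir1 i).
have [||s' ws' Qs'] := loop N (State pc0.+2 ir2 im0 fr0 fm0) => //.
  rewrite subnn; split=> //=.
  + by rewrite /ir2 /ir1 /upd (negbTE i3) eqxx s0lo s0z; lia.
  + by rewrite /ir2 /ir1 /upd /= eqxx eq_sym (negbTE ihi) s0lo s0z s0hi; lia.
  + move=> r; rewrite !inE !negb_or => /and3P[ri r3 _].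
    by rewrite /ir2 /ir1 /upd (negbTE ri) (negbTE r3).
  + apply: Qst Q0 _ _ _ => //= r; rewrite !inE !negb_or => /andP[ri r3].
    by rewrite /ir2 /ir1 /upd (negbTE ri) (negbTE r3).
exists s' => //; rewrite /for_time.
have -> : 3 + N * (t + 4) = 1 + (1 + (1 + N * (t + 4))) by lia.
rewrite -[N * k]/(0 + (0 + N * k)).
by apply: exec_seq (exec_seq _ ws'); exact: (exec_instr (p := p)).
Qed.

End Rules.

(** * Elimination as a function of the number of steps *)

Lemma addr_lt N q i j : i < N -> j < q -> i * q + j < N * q.
Proof. by move=> iN jq; have := leq_mul2r q i.+1 N; rewrite mulSn iN orbT; lia. Qed.

Lemma addr_inj q i j i' j' : j < q -> j' < q ->
  (i * q + j == i' * q + j') = (i == i') && (j == j').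
Proof.
move=> jq j'q; apply/eqP/andP=> [E|[/eqP-> /eqP->] //].
have q0 : 0 < q by lia.
have := congr1 (divn^~ q) E; have := congr1 (modn^~ q) E.
by rewrite /= !divnMDl // !divn_small // !addn0 !modnMDl !modn_small // => -> ->.
Qed.

Section Memory.
Variable F : fieldType.
Implicit Types f : nat -> F.

Lemma write_mx_in f a N q (A : 'M[F]_(N, q)) (i : 'I_N) (j : 'I_q) :
  write_mx f a A (a + i * q + j) = A i j.
Proof.
rewrite /write_mx; case: pickP => [[i' j'] /=|/(_ (i, j))]; last by rewrite /= eqxx.
rewrite -!addnA eqn_add2l addr_inj // => /andP[/eqP/val_inj-> /eqP/val_inj->] //.
Qed.

Lemma write_mx_out f a N q (A : 'M[F]_(N, q)) x : x < a -> write_mx f a A x = f x.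
Proof.
by move=> xa; rewrite /write_mx; case: pickP => // ij /eqP E; move: xa; rewrite E; lia.
Qed.

End Memory.

Section Elimination.
Variable F : fieldType.
Implicit Types W : nat -> nat -> F.
Local Open Scope ring_scope.

(** Matrices become functions on all of [nat], so that block offsets such as [lo + k] need no proof
    of being in range. *)
Definition elim_step W (k : nat) : nat -> nat -> F := fun i j =>
  if (k < i)%N && (k < j)%N then W i j - W i k / W k k * W k j else W i j.

Fixpoint elim W (h : nat) : nat -> nat -> F :=
  if h is k.+1 then elim_step (elim W k) k else W.

Lemma elim_foldl W h : elim W h = foldl elim_step W (iota 0 h).
Proof.
by elim: h => // h IH; rewrite -addn1 iotaD cats1 foldl_rcons -IH add0n addn1.
Qed.

(** Step [k] changes an entry only if both of its indices exceed [k]. *)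
Lemma elim_cap W h i j : elim W h i j = elim W (minn h (minn i j)) i j.
Proof.
elim: h => [|h IH]; first by rewrite min0n.
have [lt_h|ge_h] := ltnP h (minn i j).
  by rewrite (minn_idPl lt_h).
have -> : minn h.+1 (minn i j) = minn h (minn i j) by lia.
rewrite -IH /= /elim_step; case: andP => // -[]; lia.
Qed.

Lemma eq_elim W h h' i j : minn h (minn i j) = minn h' (minn i j) ->
  elim W h i j = elim W h' i j.
Proof. by rewrite elim_cap => ->; rewrite -elim_cap. Qed.

(** Each step subtracts one summand. It reads column and row [lo + k] after [lo + k] steps, when
    they are already final, so these may equally be read after [hi] steps; this makes the sum an
    ordinary matrix product. *)
Lemma elim_block W lo n hi i j :
  (lo + n <= hi)%N -> (hi <= i)%N -> (hi <= j)%N ->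
  elim W (lo + n) i j = elim W lo i j -
    \sum_(k < n) elim W hi i (lo + k)%N / elim W hi (lo + k)%N (lo + k)%N
                 * elim W hi (lo + k)%N j.
Proof.
move=> + hi_i hi_j; elim: n => [|n IH] le_hi.
  by rewrite big_ord0 subr0 addn0.
rewrite big_ord_recr /= addnS /= {1}/elim_step ifT; last by apply/andP; split; lia.
rewrite IH; last by lia.
rewrite opprD addrA; congr (_ - _ / _ * _); apply: eq_elim; lia.
Qed.

End Elimination.

(** * The in-place loops of the forward phase as pointwise formulas *)

Section ForwardPhase.
Variables (F : fieldType) (q : nat).
Implicit Types (c : 'M[F]_q) (k i j : 'I_q).
Local Open Scope ring_scope.

(** Updating in place is harmless: as [k] differs from [i] and is absent from [js], neither [c i k]
    nor row [k] is overwritten, and each remaining entry is read before its only change. *)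
Lemma foldl_ge_update k i c (js : seq 'I_q) x y :
  k != i -> k \notin js -> uniq js ->
  foldl (ge_update k i) c js x y
  = if (x == i) && (y \in js) then c i y - c i k / c k k * c k y else c x y.
Proof.
move=> ki; elim: js c => [|j js IH] c; first by rewrite andbF.
rewrite inE negb_or => /andP[kj kjs] /andP[jjs ujs] /=.
rewrite IH // !mxE inE (negbTE ki) (negbTE kj) andbF /= eqxx /=.
case: (eqVneq x i) => [->|//] /=; case: (eqVneq y j) => [->|//] /=.
by rewrite (negbTE jjs).
Qed.

Lemma ge_rowE k i c x y : k != i ->
  ge_row k c i x y =
  if (x == i) && (k < y)%N then c i y - c i k / c k k * c k y else c x y.
Proof.
move=> ki; rewrite foldl_ge_update //.
- by rewrite mem_filter mem_enum andbT.
- by rewrite mem_filter ltnn.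
- by rewrite filter_uniq ?enum_uniq.
Qed.

Lemma foldl_ge_row k c (rs : seq 'I_q) x y :
  k \notin rs -> uniq rs ->
  foldl (ge_row k) c rs x y
  = if (x \in rs) && (k < y)%N then c x y - c x k / c k k * c k y else c x y.
Proof.
elim: rs c => [//|i rs IH] c.
rewrite inE negb_or => /andP[ki krs] /andP[irs urs] /=.
rewrite IH // !ge_rowE // inE (negbTE ki) ltnn !andbF /=.
case: (eqVneq x i) => [->|//] /=.
by rewrite (negbTE irs).
Qed.

Lemma ge_stepE k c i j :
  ge_step c k i j =
  if [&& (k < i)%N, (i.+1 < q)%N & (k < j)%N] then c i j - c i k / c k k * c k j
  else c i j.
Proof.
rewrite foldl_ge_row.
- by rewrite mem_filter mem_enum andbT andbA.
- by rewrite mem_filter ltnn.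
- by rewrite filter_uniq ?enum_uniq.
Qed.

(* The last row being zero, the iterations and the row that the forward phase
   omits would not change anything. *)
Lemma forward_phase_elim c (W : nat -> nat -> F) :
  is_system c -> (forall i j, c i j = W i j) ->
  forall i j, forward_phase c i j = elim W q i j.
Proof.
rewrite /forward_phase /ge_steps elim_foldl -val_enum_ord.
elim: (enum 'I_q) c W => [|k s IH] c W //= sysc cW.
rewrite ltn_ord andbT; case: ifP => kq /=; apply: IH => i j.
- by move=> iq; rewrite ge_stepE iq ltnn andbF sysc.
- rewrite ge_stepE /elim_step -!cW.
  have [iq|iq] := ltnP i.+1 q; first by rewrite /=.
  have {}iq : i.+1 = q by have := ltn_ord i; lia.
  by rewrite /= andbF !(sysc i _ iq) !mul0r subr0 if_same.
- exact: sysc.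
- rewrite /elim_step -!cW; case: ifP => // /andP[ki kj].
  have iq : i.+1 = q by have := ltn_ord i; lia.
  by rewrite !(sysc i _ iq) !mul0r subr0.
Qed.

End ForwardPhase.

(** * The blocked algorithm *)

Coercion Instr : instr >-> cmd.
Local Notation "c1 ;; c2" := (Seq c1 c2)
  (at level 61, right associativity, only parsing).

Local Notation rq := 0%N.
Local Notation rp := 1%N.
Local Notation rone := 2%N.
Local Notation rlo := 4%N.
Local Notation rhi := 5%N.
Local Notation rk := 6%N.
Local Notation rf := 7%N.
Local Notation re := 8%N.
Local Notation rjlo := 9%N.
Local Notation rjhi := 10%N.
Local Notation ri := 11%N.
Local Notation rj := 12%N.
Local Notation rA := 13%N.
Local Notation rB := 14%N.
Local Notation rC := 15%N.
Local Notation ra := 16%N.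
Local Notation rb := 17%N.
Local Notation rg := 18%N.
Local Notation rh := 19%N.
Local Notation ru := 20%N.
Local Notation rv := 21%N.
Local Notation rzero := 22%N.
Local Notation rx := 23%N.

(* Field register 4 receives the inverse of field register 1, or 0 if there is
   none: the entry [(q - 2, q - 2)] may be zero, and a division would fault. *)
Definition invert : cmd :=
  If (TF 1) (FSet 4 0;; FSet 4 0) (FSet 4 1;; FDiv 4 4 1).

(** The condition becomes a factor 1 or 0 of the correction instead of a jump around the update, so
    that an idle update costs as much as a real one. *)
Definition guard : cmd := If (TI rg) (FSet 5 1) (FSet 5 0).

Definition cell_update : cmd :=
  ILoad ra ri;; IAdd ra ra rk;; FLoad 0 ra;;
  ILoad ra rk;; IAdd rb ra rk;; FLoad 1 rb;; IAdd rb ra rj;; FLoad 2 rb;;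
  ILoad ra ri;; IAdd ra ra rj;; FLoad 3 ra;;
  invert;; guard;;
  FMul 0 0 4;; FMul 0 0 2;; FMul 0 0 5;; FSub 3 3 0;; FStore ra 3.

(* By truncated subtraction, register [rg] becomes 0 iff [k < f <= e]. *)
Definition upper_guard : cmd :=
  ISub rg rf rk;; ISub rg rone rg;; ISub rh rf re;; IAdd rg rg rh;;
  IAdd ri rf rzero;; IAdd rj re rzero.

(* Here [rg] becomes 0 iff [k < f < e]. *)
Definition lower_guard : cmd :=
  ISub rg rf rk;; ISub rg rone rg;; ISub rh re rf;; ISub rh rone rh;;
  IAdd rg rg rh;; IAdd ri re rzero;; IAdd rj rf rzero.

Definition panel_body : cmd :=
  (upper_guard;; cell_update);; (lower_guard;; cell_update).

(* For given [k], the pair [(f, e)] of loop indices takes care of the entries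
   with minimal index [f] and maximal index [e]. *)
Definition panel : cmd :=
  For rk rlo rhi rone (For rf rlo rhi rone (For re rzero rq rone panel_body)).

(** It is run for every row. Rows above [hi] yield meaningless quotients, but these only reach rows
    of the product that the guard of [subtract_body] discards. *)
Definition left_body : cmd :=
  ILoad ra ri;; IAdd ra ra rk;; FLoad 0 ra;;
  ILoad ra rk;; IAdd ra ra rk;; FLoad 1 ra;; invert;; FMul 0 0 4;;
  IAdd ra rq ri;; ILoad ra ra;; ISub rb rk rlo;; IAdd ra ra rb;;
  IAdd ra rA ra;; FStore ra 0.

Definition left_factor : cmd :=
  For ri rzero rq rone (For rk rlo rhi rone left_body).

Definition right_body : cmd :=
  ILoad ra rk;; IAdd ra ra rj;; FLoad 0 ra;;
  ISub ra rk rlo;; IAdd ra rq ra;; ILoad ra ra;; ISub rb rj rjlo;;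
  IAdd ra ra rb;; IAdd ra rB ra;; FStore ra 0.

Definition right_factor : cmd :=
  For rk rlo rhi rone (For rj rjlo rjhi rone right_body).

Definition subtract_body : cmd :=
  ISub rg rhi ri;; ISub rh rhi rj;; IAdd rg rg rh;; guard;;
  IAdd ra rq ri;; ILoad ra ra;; ISub rb rj rjlo;; IAdd ra ra rb;;
  IAdd ra rC ra;; FLoad 0 ra;; ILoad ra ri;; IAdd ra ra rj;; FLoad 3 ra;;
  FMul 0 0 5;; FSub 3 3 0;; FStore ra 3.

Definition subtract_product : cmd :=
  For ri rzero rq rone (For rj rjlo rjhi rone subtract_body).

Definition column_step : cmd :=
  IAdd rjhi rjlo rp;; right_factor;; Tensor rA rB rC rq;; subtract_product.

Definition block_step : cmd :=
  IAdd rhi rlo rp;; panel;; left_factor;; For rjlo rzero rq rp column_step.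

(* Without a multiplication on integers, row addresses are looked up: memory
   cell [x] holds [x * q], and cell [q + x] holds [x * p]. *)
Definition tables_body : cmd :=
  IStore rx ru;; IAdd ra rq rx;; IStore ra rv;; IAdd ru ru rq;; IAdd rv rv rp.

Definition tables : cmd := For rx rzero rq rone tables_body.

(** The accumulators [ru] and [rv] of the tables end at [q * q] and [q * p]; their sums give the
    bases of the workspaces for the left factor, the right factor and the product, placed one after
    the other behind the matrix. *)
Definition blocked_elimination : cmd :=
  ISet rone 1;; tables;;
  IAdd rA ru rzero;; IAdd rB ru rv;; IAdd rC rB rv;;
  For rlo rzero rq rp block_step.

(** * Effect of the loop bodies on the memory *)

Section Program.
Variables (F : fieldType) (q p : nat).
Implicit Types (s : state F) (fm : nat -> F).

Definition constants := [:: rq; rp; rone; rzero; rA; rB; rC].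

Definition ready s : Prop :=
  [/\ [/\ ireg s rq = q, ireg s rp = p, ireg s rone = 1 & ireg s rzero = 0],
      [/\ ireg s rA = q * q, ireg s rB = q * q + q * p
        & ireg s rC = q * q + q * p + q * p],
      forall x, x < q -> imem s x = x * q
    & forall x, x < q -> imem s (q + x) = x * p].

Lemma ready_frame s s' : ready s -> {in constants, ireg s' =1 ireg s} ->
  imem s' = imem s -> ready s'.
Proof.
case=> -[? ? ? ?] [? ? ?] ? ? E Em.
by split; rewrite ?Em //; split; rewrite E.
Qed.

Lemma exec_ready c s t k s' : exec p c s t k s' -> ready s ->
  keeps_imem c && all [predC modified c] constants -> ready s'.
Proof.
move=> /exec_frame[fr im] rs /andP[/im {}im /allP mc].
by apply: ready_frame rs _ im => r /mc; apply: fr.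
Qed.

(** The register conditions form one closed boolean, discharged by [isT] at each use, and [ready] is
    carried through the loop once and for all. *)
Lemma for_ready i lo hi d c a N e t k s0 (Q : nat -> (nat -> F) -> Prop) :
  [&& [&& i \notin modified c, hi \notin modified c, d \notin modified c,
      i != hi, i != d, i != 3, hi != 3 & d != 3],
      keeps_imem c & all [predC [:: i, 3 & modified c]] constants] ->
  ready s0 -> ireg s0 lo = a -> ireg s0 hi = a + N * e -> ireg s0 d = e ->
  0 < e -> Q 0 (fmem s0) ->
  (forall x s, x < N -> ireg s i = a + x * e -> ready s ->
     {in [predC [:: i, 3 & modified c]], ireg s =1 ireg s0} -> Q x (fmem s) ->
     exists2 s', exec p c s t k s' & Q x.+1 (fmem s')) ->
  exists2 s', exec p (For i lo hi d c) s0 (for_time N t) (N * k) s'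
    & Q N (fmem s').
Proof.
case/and3P=> wf kc /allP cc rs0 s0lo s0hi s0d e0 Q0 body.
apply: (for_rule (a := a) (e := e) (Q := fun x s => Q x (fmem s))) => //.
- by case: rs0 => -[].
- by move=> x s s' Qs _ ->.
- move=> x s xN si fr im Qs; apply: body => //.
  by apply: ready_frame rs0 _ (im kc) => r /cc; apply: fr.
Qed.

Lemma for_ready1 i lo hi c a N t k s0 (Q : nat -> (nat -> F) -> Prop) :
  [&& [&& i \notin modified c, hi \notin modified c, rone \notin modified c,
      i != hi, i != rone, i != 3, hi != 3 & rone != 3],
      keeps_imem c & all [predC [:: i, 3 & modified c]] constants] ->
  ready s0 -> ireg s0 lo = a -> ireg s0 hi = a + N -> Q a (fmem s0) ->
  (forall x s, a <= x < a + N -> ireg s i = x -> ready s ->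
     {in [predC [:: i, 3 & modified c]], ireg s =1 ireg s0} -> Q x (fmem s) ->
     exists2 s', exec p c s t k s' & Q x.+1 (fmem s')) ->
  exists2 s', exec p (For i lo hi rone c) s0 (for_time N t) (N * k) s'
    & Q (a + N) (fmem s').
Proof.
move=> wf rs0 s0lo s0hi Q0 body.
apply: (for_ready (a := a) (N := N) (e := 1) (Q := fun x => Q (a + x)) wf rs0) => //.
- by rewrite muln1.
- by case: rs0 => -[].
- by rewrite addn0.
- move=> x s xN; rewrite muln1 => si rs fr Qx; rewrite addnS.
  by apply: body => //; lia.
Qed.

Local Open Scope ring_scope.

Lemma cell_update_exec s i j k g : ready s -> (i < q)%N -> (j < q)%N -> (k < q)%N ->
  ireg s ri = i -> ireg s rj = j -> ireg s rk = k -> (ireg s rg == 0%N) = g ->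
  exists2 s', exec p cell_update s (static_time cell_update) 0 s' &
    fmem s' = upd (fmem s) (i * q + j)
      (fmem s (i * q + j)%N - fmem s (i * q + k)%N / fmem s (k * q + k)%N
         * fmem s (k * q + j)%N * (nat_of_bool g)%:R).
Proof.
case: s => c ir im fr fm [/= _ _ imq _] iq jq kq si sj sk sg.
(* For a zero divisor the machine multiplies by 0, which is what the field division means in the
   stated result. *)
have [d0|d0] := eqVneq (fm (k * q + k)%N) 0; case: g sg => sg; eexists.
- apply: eval_exec => //.
  rewrite /= /upd /= sk si sj !imq // d0 eqxx /= sg /=; reflexivity.
- by rewrite /= d0 invr0.
- apply: eval_exec => //.
  rewrite /= /upd /= sk si sj !imq // d0 eqxx /= sg /=; reflexivity.
- by rewrite /= d0 invr0.
- apply: eval_exec => //.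
  rewrite /= /upd /= sk si sj !imq // (negbTE d0) /= sg /=; reflexivity.
- by rewrite /= div1r.
- apply: eval_exec => //.
  rewrite /= /upd /= sk si sj !imq // (negbTE d0) /= sg /=; reflexivity.
- by rewrite /= div1r.
Qed.

Definition cell_result fm i j k (g : bool) : nat -> F :=
  upd fm (i * q + j)
    (fm (i * q + j)%N - fm (i * q + k)%N / fm (k * q + k)%N * fm (k * q + j)%N
       * g%:R).

(** One guard is weak and the other strict in [f] and [e]: the diagonal entry [f = e], which both
    halves address, must be updated only once. *)
Lemma panel_body_exec s k f e : ready s -> (k < q)%N -> (f < q)%N -> (e < q)%N ->
  ireg s rk = k -> ireg s rf = f -> ireg s re = e ->
  exists2 s', exec p panel_body s (static_time panel_body) 0 s' &
    fmem s' = cell_result (cell_result (fmem s) f e k (k < f <= e)%N) e f k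
                          (k < f < e)%N.
Proof.
move=> rs kq fq eq_ sk sf se.
have [s1 [e1 m1 i1 j1 /andP[g1 k1]]] : exists s1,
    [/\ exec p upper_guard s (static_time upper_guard) 0 s1, fmem s1 = fmem s,
        ireg s1 ri = f, ireg s1 rj = e
      & ((ireg s1 rg == 0%N) == (k < f <= e)%N) && (ireg s1 rk == k)].
  case: s rs sk sf se => c ir im fr fm [/= [_ _ s1 s0] _ _ _] sk sf se.
  eexists; split; first by apply: eval_exec => //=; reflexivity.
  - by [].
  - by rewrite /= /upd /= sf s0; lia.
  - by rewrite /= /upd /= se s0; lia.
  - by rewrite /= /upd /= sk sf se s1; lia.
have rs1 := exec_ready e1 rs isT.
have [s2 e2 m2] := cell_update_exec rs1 fq eq_ kq i1 j1 (eqP k1) (eqP g1).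
have [fr1 _] := exec_frame e1; have [fr2 _] := exec_frame e2.
have rs2 := exec_ready e2 rs1 isT.
have {}sk : ireg s2 rk = k by rewrite fr2 // fr1.
have {}sf : ireg s2 rf = f by rewrite fr2 // fr1.
have {}se : ireg s2 re = e by rewrite fr2 // fr1.
have [s3 [e3 m3 i3 j3 /andP[g3 k3]]] : exists s3,
    [/\ exec p lower_guard s2 (static_time lower_guard) 0 s3, fmem s3 = fmem s2,
        ireg s3 ri = e, ireg s3 rj = f
      & ((ireg s3 rg == 0%N) == (k < f < e)%N) && (ireg s3 rk == k)].
  case: s2 rs2 sk sf se {e2 m2 fr2} => c ir im fr fm [/= [_ _ s2 s0] _ _ _] sk sf se.
  eexists; split; first by apply: eval_exec => //=; reflexivity.
  - by [].
  - by rewrite /= /upd /= se s0; lia.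
  - by rewrite /= /upd /= sf s0; lia.
  - by rewrite /= /upd /= sk sf se s2; lia.
have rs3 := exec_ready e3 rs2 isT.
have [s4 e4 m4] := cell_update_exec rs3 eq_ fq kq i3 j3 (eqP k3) (eqP g3).
exists s4; last by rewrite m4 m3 m2 m1.
exact: exec_seq (exec_seq e1 e2) (exec_seq e3 e4).
Qed.

Lemma left_body_exec s i k lo : ready s -> (i < q)%N -> (k < q)%N ->
  ireg s ri = i -> ireg s rk = k -> ireg s rlo = lo ->
  exists2 s', exec p left_body s (static_time left_body) 0 s' &
    fmem s' = upd (fmem s) (q * q + (i * p + (k - lo)))
      (fmem s (i * q + k)%N / fmem s (k * q + k)%N).
Proof.
case: s => c ir im fr fm [/= [s0 _ _ _] [sA _ _] imq imp] iq kq si sk sl.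
have [d0|d0] := eqVneq (fm (k * q + k)%N) 0; eexists.
- apply: eval_exec => //.
  rewrite /= /upd /= sk si !imq // d0 eqxx /= /upd /=.
  rewrite s0 sA sl sk si imp //; reflexivity.
- by rewrite /= d0 invr0.
- apply: eval_exec => //.
  rewrite /= /upd /= sk si !imq // (negbTE d0) /= /upd /=.
  rewrite s0 sA sl sk si imp //; reflexivity.
- by rewrite /= div1r.
Qed.

Lemma right_body_exec s k j lo jlo : ready s -> (k < q)%N ->
  ireg s rk = k -> ireg s rj = j -> ireg s rlo = lo -> ireg s rjlo = jlo ->
  exists2 s', exec p right_body s (static_time right_body) 0 s' &
    fmem s' = upd (fmem s) (q * q + q * p + ((k - lo) * p + (j - jlo)))
      (fmem s (k * q + j)%N).
Proof.
case: s => c ir im fr fm [/= [s0 _ _ _] [_ sB _] imq imp] kq sk sj sl sjl.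
have klq : (k - lo < q)%N := leq_ltn_trans (leq_subr _ _) kq.
eexists; first apply: eval_exec => //.
  rewrite /= /upd /= s0 sB sl sk sj sjl (imq k kq) (imp _ klq); reflexivity.
Qed.

Lemma subtract_body_exec s i j hi jlo : ready s -> (i < q)%N ->
  ireg s ri = i -> ireg s rj = j -> ireg s rhi = hi -> ireg s rjlo = jlo ->
  exists2 s', exec p subtract_body s (static_time subtract_body) 0 s' &
    fmem s' = upd (fmem s) (i * q + j)
      (fmem s (i * q + j)%N -
       fmem s (q * q + q * p + q * p + (i * p + (j - jlo)))%N
       * ((hi <= i) && (hi <= j))%N%:R).
Proof.
case: s => c ir im fr fm [/= [s0 _ _ _] [_ _ sC] imq imp] iq si sj sh sjl.
have gE : (hi - i + (hi - j) == 0)%N = (hi <= i)%N && (hi <= j)%N by lia.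
case g : (_ && _) in gE *; eexists.
- apply: eval_exec => //.
  rewrite /= /upd /= sh si sj gE /= /upd /= s0 sC si sj sjl.
  rewrite (imq i iq) (imp i iq); reflexivity.
- by [].
- apply: eval_exec => //.
  rewrite /= /upd /= sh si sj gE /= /upd /= s0 sC si sj sjl.
  rewrite (imq i iq) (imp i iq); reflexivity.
- by [].
Qed.

Variable W : nat -> nat -> F.

(* Entry [(i, j)] has undergone the first [cn i j] elimination steps. *)
Definition progress fm (cn : nat -> nat -> nat) : Prop :=
  forall i j, (i < q)%N -> (j < q)%N -> fm (i * q + j)%N = elim W (cn i j) i j.

(** Counts matter only up to the smaller index; this absorbs all disagreement between invariants on
    entries that are already final. *)
Lemma eq_progress fm cn cn' : progress fm cn ->
  (forall i j, (i < q)%N -> (j < q)%N ->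
     minn (cn i j) (minn i j) = minn (cn' i j) (minn i j)) ->
  progress fm cn'.
Proof. by move=> h E i j iq jq; rewrite h //; apply: eq_elim; apply: E. Qed.

Lemma progress_upd_out fm cn x v : progress fm cn -> (q * q <= x)%N ->
  progress (upd fm x v) cn.
Proof.
move=> h qx i j iq jq; rewrite /upd ifF ?h //.
by apply/eqP; have := addr_lt iq jq; lia.
Qed.

Lemma progress_upd fm cn cn' i j v : progress fm cn -> (i < q)%N -> (j < q)%N ->
  v = elim W (cn' i j) i j ->
  (forall x y, (x < q)%N -> (y < q)%N -> (x, y) != (i, j) ->
     minn (cn x y) (minn x y) = minn (cn' x y) (minn x y)) ->
  progress (upd fm (i * q + j) v) cn'.
Proof.
move=> h iq jq vE E x y xq yq; rewrite /upd addr_inj //.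
have [/andP[/eqP-> /eqP->] //|ne] := ifP.
by rewrite h //; apply: eq_elim; apply: E; rewrite // xpair_eqE ne.
Qed.

(** The updated entry must be at step [k] exactly; for the three other entries read, which have an
    index equal to [k], any count from [k] on means final. *)
Lemma progress_cell_result fm cn i j k (g : bool) : progress fm cn ->
  (i < q)%N -> (j < q)%N -> (k < q)%N ->
  (g -> [&& k < i, k < j, cn i j == k, k <= cn i k, k <= cn k k & k <= cn k j]%N) ->
  progress (cell_result fm i j k g)
    (fun x y => if [&& g, x == i & y == j] then k.+1 else cn x y).
Proof.
move=> h iq jq kq Hg; apply: (progress_upd h iq jq).
  rewrite !eqxx !andbT !h //; case: g Hg => [/(_ isT)|_].
    case/and5P=> ki kj /eqP-> ik /andP[kk kj'].
    rewrite /= mulr1 /elim_step ki kj; congr (_ - _ / _ * _); apply: eq_elim; lia.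
  by rewrite mulr0 subr0.
move=> x y _ _; rewrite xpair_eqE => /negbTE ->; by rewrite andbF.
Qed.

(** Round [k] visits the entries in lexicographic order of their smaller and larger index; those
    before [(f, e)] have received step [k]. *)
Definition panel_count lo hi k f e i j : nat :=
  if (minn i j < hi)%N then
    (k + ((minn i j < f) || (minn i j == f) && (maxn i j < e)))%N
  else lo.

End Program.

(** * Invariants of the blocked algorithm *)

Section Phases.
Variables (F : fieldType) (q p : nat) (W : nat -> nat -> F).
Hypotheses (p_gt0 : 0 < p) (p_le_q : p <= q).
Implicit Types (s : state F) (fm : nat -> F).

Local Notation ready := (@ready F q p).
Local Notation progress := (progress q W).
Local Open Scope ring_scope.

Lemma panel_count_ge lo hi k f e i j : (minn i j < hi)%N ->
  (k <= panel_count lo hi k f e i j)%N.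
Proof. by rewrite /panel_count => ->; rewrite leq_addr. Qed.

Lemma panel_count_todo lo hi k f e i j : (minn i j < hi)%N ->
  minn i j = f -> maxn i j = e -> panel_count lo hi k f e i j = k.
Proof. by rewrite /panel_count => -> -> ->; rewrite !ltnn andbF addn0. Qed.

Lemma panel_body_progress lo hi k f e s : (lo <= k < hi)%N -> (lo <= f < hi)%N ->
  (hi <= q)%N -> (e < q)%N ->
  ready s -> ireg s rk = k -> ireg s rf = f -> ireg s re = e ->
  progress (fmem s) (panel_count lo hi k f e) ->
  exists2 s', exec p panel_body s (static_time panel_body) 0 s'
    & progress (fmem s') (panel_count lo hi k f e.+1).
Proof.
move=> k_in f_in hiq eq_ rs sk sf se h.
have kq : (k < q)%N by lia.
have fq : (f < q)%N by lia.
have [s' es' fs'] := panel_body_exec rs kq fq eq_ sk sf se.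
exists s' => //; rewrite fs'.
have {}h : progress (cell_result q (fmem s) f e k (k < f <= e)%N)
    (fun x y => if [&& (k < f <= e)%N, x == f & y == e] then k.+1
                else panel_count lo hi k f e x y).
  apply: progress_cell_result => // /andP[kf fe].
  rewrite panel_count_todo ?panel_count_ge; lia.
(* The first update changed only [(f, e)], which for [k < f < e] is none of the entries [(e, f)],
   [(e, k)], [(k, k)], [(k, f)] read by the second. *)
have {}h := @progress_cell_result _ _ _ _ _ e f k (k < f < e)%N h eq_ fq kq.
apply: eq_progress (h _) _.
  move=> /andP[kf fe].
  have -> : (e == f) = false by lia.
  have -> : (k == f) = false by lia.
  by rewrite /= !andbF /= panel_count_todo ?panel_count_ge; lia.
move=> i j iq jq; rewrite /panel_count.
case: ifP => [/and3P[g /eqP-> /eqP->]|N1].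
  by rewrite ifT; lia.
case: ifP => [/and3P[g /eqP-> /eqP->]|N2].
  by rewrite ifT; lia.
by case: ifP => // _; lia.
Qed.

Definition block_count lo hi i j : nat := if (minn i j < hi)%N then hi else lo.

Lemma panel_exec s lo : ready s -> (lo + p <= q)%N ->
  ireg s rlo = lo -> ireg s rhi = (lo + p)%N -> progress (fmem s) (fun _ _ => lo) ->
  exists2 s', exec p panel s
      (for_time p (for_time p (for_time q (static_time panel_body)))) 0 s'
    & progress (fmem s') (block_count lo (lo + p)).
Proof.
move=> rs hiq sl sh h; set hi := (lo + p)%N.
have s0z s' : ready s' -> ireg s' rzero = 0%N by case=> -[].
have s0q s' : ready s' -> ireg s' rq = q by case=> -[].
have [|k s1 k_in sk rs1 fr1 h1|s' es' h'] := for_ready1 (i := rk) (lo := rlo) (hi := rhi)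
  (c := For rf rlo rhi rone (For re rzero rq rone panel_body))
  (t := for_time p (for_time q (static_time panel_body))) (k := 0)
  (Q := fun k fm => progress fm (panel_count lo hi k lo 0)) isT rs sl sh.
- by apply: eq_progress h _ => i j iq jq; rewrite /panel_count; case: ifP => _; lia.
- have [|||f s2 f_in sf rs2 fr2 h2|s' es' h'] := for_ready1 (i := rf)
    (lo := rlo) (hi := rhi) (c := For re rzero rq rone panel_body) (a := lo) (N := p)
    (t := for_time q (static_time panel_body)) (k := 0)
    (Q := fun f fm => progress fm (panel_count lo hi k f 0)) isT rs1.
  + by rewrite fr1.
  + by rewrite fr1.
  + exact: h1.
  + have [|e s3 e_in se rs3 fr3 h3|s' es' h'] := for_ready1 (i := re)
      (lo := rzero) (hi := rq) (c := panel_body) (a := 0) (N := q)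
      (t := static_time panel_body) (k := 0)
      (Q := fun e fm => progress fm (panel_count lo hi k f e))
      isT rs2 (s0z _ rs2) (s0q _ rs2).
    * exact: h2.
    * apply: (panel_body_progress k_in f_in hiq _ rs3 _ _ se h3) => //.
        by rewrite fr3 // fr2.
      by rewrite fr3.
    exists s'; first by rewrite muln0 in es'.
    apply: (eq_progress (cn := panel_count lo hi k f q) h') => i j iq jq.
    rewrite /panel_count.
    by case: ifP => // ?; lia.
  exists s'; first by rewrite muln0 in es'.
  (* The end of round [k] is the start of round [k + 1]: the two counts differ only where the
     smaller index is below [lo], and there both exceed it. *)
  apply: (eq_progress (cn := panel_count lo hi k hi 0) h') => i j iq jq.
  rewrite /panel_count.
  by case: ifP => // ?; lia.
exists s'; first by rewrite muln0 in es'.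
apply: (eq_progress (cn := panel_count lo hi hi lo 0) h') => i j iq jq.
by rewrite /panel_count /block_count; case: ifP => // ?; lia.
Qed.

Definition filled fm (base : nat) (v : nat -> nat -> F) n i0 j0 : Prop :=
  forall i j, (i < n)%N -> (j < p)%N -> ((i < i0) || (i == i0) && (j < j0))%N ->
  fm (base + (i * p + j))%N = v i j.

Lemma filled0 fm base v n : filled fm base v n 0 0.
Proof. by move=> i j _ _; rewrite !ltn0 andbF. Qed.

Lemma filled_upd fm base v n i0 j0 : (j0 < p)%N -> filled fm base v n i0 j0 ->
  filled (upd fm (base + (i0 * p + j0)) (v i0 j0)) base v n i0 j0.+1.
Proof.
move=> j0p h i j iq jp ij; rewrite /upd eqn_add2l addr_inj //.
case: ifP => [/andP[/eqP-> /eqP->] //|N]; apply: h => //; lia.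
Qed.

Lemma filled_row fm base v n i0 : filled fm base v n i0 p ->
  filled fm base v n i0.+1 0.
Proof. by move=> h i j iq jp ij; apply: h => //; lia. Qed.

Lemma filled_all fm base v n i0 : (n <= i0)%N -> filled fm base v n i0 0 ->
  forall i j, (i < n)%N -> (j < p)%N -> fm (base + (i * p + j))%N = v i j.
Proof. by move=> ni0 h i j iq jp; apply: h => //; lia. Qed.

Definition multiplier lo i k : F :=
  elim W (lo + p) i (lo + k)%N / elim W (lo + p) (lo + k)%N (lo + k)%N.

Definition left_ready fm lo : Prop :=
  forall i k, (i < q)%N -> (k < p)%N ->
  fm (q * q + (i * p + k))%N = multiplier lo i k.

Lemma left_factor_exec s lo : ready s -> (lo + p <= q)%N ->
  ireg s rlo = lo -> ireg s rhi = (lo + p)%N ->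
  progress (fmem s) (block_count lo (lo + p)) ->
  exists2 s', exec p left_factor s
      (for_time q (for_time p (static_time left_body))) 0 s'
    & progress (fmem s') (block_count lo (lo + p)) /\ left_ready (fmem s') lo.
Proof.
move=> rs hiq sl sh h.
have s0z s' : ready s' -> ireg s' rzero = 0%N by case=> -[].
have s0q s' : ready s' -> ireg s' rq = q by case=> -[].
have [|i s1 i_in si rs1 fr1 [h1 f1]|s' es' [h' f']] := for_ready1 (i := ri)
  (lo := rzero) (hi := rq) (c := For rk rlo rhi rone left_body) (a := 0) (N := q)
  (t := for_time p (static_time left_body)) (k := 0)
  (Q := fun i fm => progress fm (block_count lo (lo + p))
     /\ filled fm (q * q) (multiplier lo) q i 0) isT rs (s0z _ rs) (s0q _ rs).
- by split=> //; apply: filled0.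
- have [|||k s2 k_in sk rs2 fr2 [h2 f2]|s' es' [h' f']] := for_ready1 (i := rk)
    (lo := rlo) (hi := rhi) (c := left_body) (a := lo) (N := p)
    (t := static_time left_body) (k := 0)
    (Q := fun k fm => progress fm (block_count lo (lo + p))
       /\ filled fm (q * q) (multiplier lo) q i (k - lo)) isT rs1.
  + by rewrite fr1.
  + by rewrite fr1.
  + by rewrite subnn.
  + have kq : (k < q)%N by lia.
    have iq : (i < q)%N by lia.
    have [|||s' es' fs'] := @left_body_exec _ _ _ s2 i k lo rs2 iq kq.
    * by rewrite fr2.
    * by [].
    * by rewrite fr2 // fr1.
    exists s' => //; rewrite fs'; split.
      by apply: progress_upd_out => //; lia.
    have k_eq : (lo + (k - lo))%N = k by lia.
    rewrite subSn; last by lia.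
    have -> : fmem s2 (i * q + k)%N / fmem s2 (k * q + k)%N = multiplier lo i (k - lo).
      by rewrite /multiplier k_eq !h2 // /block_count !ifT //; lia.
    by apply: filled_upd => //; lia.
  exists s'; first by rewrite muln0 in es'.
  by split=> //; apply: filled_row; rewrite addKn in f'.
exists s'; first by rewrite muln0 in es'.
by split=> // i k iq kp; apply: filled_all f' _ _ _ _.
Qed.

Definition right_ready fm lo jlo : Prop :=
  forall k j, (k < p)%N -> (j < p)%N ->
  fm (q * q + q * p + (k * p + j))%N = elim W (lo + p) (lo + k)%N (jlo + j)%N.

Definition column_count lo hi jlo i j : nat :=
  if (minn i j < hi)%N || (j < jlo)%N then hi else lo.

Lemma left_ready_upd_out fm lo x v : (x < q * q)%N || (q * q + q * p <= x)%N ->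
  left_ready fm lo -> left_ready (upd fm x v) lo.
Proof.
move=> x_out h i k iq kp; rewrite /upd ifF ?h //.
by apply/eqP; have := addr_lt iq kp; lia.
Qed.

Lemma right_factor_exec s lo jlo : ready s -> (lo + p <= q)%N -> (jlo + p <= q)%N ->
  ireg s rlo = lo -> ireg s rhi = (lo + p)%N ->
  ireg s rjlo = jlo -> ireg s rjhi = (jlo + p)%N ->
  progress (fmem s) (column_count lo (lo + p) jlo) -> left_ready (fmem s) lo ->
  exists2 s', exec p right_factor s
      (for_time p (for_time p (static_time right_body))) 0 s'
    & [/\ progress (fmem s') (column_count lo (lo + p) jlo),
          left_ready (fmem s') lo & right_ready (fmem s') lo jlo].
Proof.
move=> rs hiq jhiq sl sh sjl sjh h l.
pose V k j := elim W (lo + p) (lo + k)%N (jlo + j)%N.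
have [|k s1 k_in sk rs1 fr1 [h1 l1 f1]|s' es' [h' l' f']] := for_ready1 (i := rk)
  (lo := rlo) (hi := rhi) (c := For rj rjlo rjhi rone right_body)
  (t := for_time p (static_time right_body)) (k := 0)
  (Q := fun k fm => [/\ progress fm (column_count lo (lo + p) jlo), left_ready fm lo
     & filled fm (q * q + q * p) V p (k - lo) 0]) isT rs sl sh.
- by rewrite subnn; split=> //; apply: filled0.
- have [|||j s2 j_in sj rs2 fr2 [h2 l2 f2]|s' es' [h' l' f']] := for_ready1 (i := rj)
    (lo := rjlo) (hi := rjhi) (c := right_body) (a := jlo) (N := p)
    (t := static_time right_body) (k := 0)
    (Q := fun j fm => [/\ progress fm (column_count lo (lo + p) jlo), left_ready fm lo
       & filled fm (q * q + q * p) V p (k - lo) (j - jlo)]) isT rs1.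
  + by rewrite fr1.
  + by rewrite fr1.
  + by rewrite subnn.
  + have kq : (k < q)%N by lia.
    have [||||s' es' fs'] := @right_body_exec _ _ _ s2 k j lo jlo rs2 kq.
    * by rewrite fr2.
    * by [].
    * by rewrite fr2 // fr1.
    * by rewrite fr2 // fr1.
    exists s' => //; rewrite fs'; split.
    * by apply: progress_upd_out => //; rewrite -addnA leq_addr.
    * by apply: left_ready_upd_out => //; rewrite leq_addr orbT.
    rewrite [(j.+1 - _)%N]subSn; last by lia.
    have -> : fmem s2 (k * q + j)%N = V (k - lo)%N (j - jlo)%N.
      have k_eq : (lo + (k - lo))%N = k by lia.
      have j_eq : (jlo + (j - jlo))%N = j by lia.
      rewrite /V k_eq j_eq.
      have jq : (j < q)%N by lia.
      by rewrite h2 // /column_count ifT //; lia.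
    by apply: filled_upd => //; lia.
  exists s'; first by rewrite muln0 in es'.
  split=> //; rewrite subSn; last by lia.
  by apply: filled_row; rewrite addKn in f'.
exists s'; first by rewrite muln0 in es'.
split=> // k j kp jp; rewrite addKn in f'.
by apply: (filled_all _ f').
Qed.

Definition product_ready fm lo jlo : Prop :=
  forall i j, (i < q)%N -> (j < p)%N ->
  fm (q * q + q * p + q * p + (i * p + j))%N =
  \sum_(k < p) multiplier lo i k * elim W (lo + p) (lo + k)%N (jlo + j)%N.

(** The output lies behind the matrix and the left factor, which both survive. The right factor is
    not tracked further, being rebuilt for the next column block. *)
Lemma tensor_exec s lo jlo cn : ready s ->
  progress (fmem s) cn -> left_ready (fmem s) lo -> right_ready (fmem s) lo jlo ->
  exists2 s', exec p (Tensor rA rB rC rq) s (q * p) 1 s'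
    & [/\ progress (fmem s') cn, left_ready (fmem s') lo
        & product_ready (fmem s') lo jlo].
Proof.
case: s => c ir im fr fm [/= [s0 _ _ _] [sA sB sC] _ _] h l r.
pose s' := State c.+1 ir im fr (write_mx fm (ir rC)
  (read_mx fm (ir rA) (ir rq) p *m read_mx fm (ir rB) p p)).
exists s'.
  have -> : (q * p)%N = unit_time p (Tensor rA rB rC rq) (State c ir im fr fm).
    by rewrite /= s0.
  apply: (exec_instr (i := Tensor rA rB rC rq)) => //=.
  by rewrite ifT // s0.
rewrite /s' /= sA sB sC s0; split.
- by move=> i j iq jq; rewrite write_mx_out ?h //; have := addr_lt iq jq; lia.
- by move=> i k iq kp; rewrite write_mx_out ?l //; have := addr_lt iq kp; lia.
- move=> i j iq jp; rewrite addnA.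
  rewrite (write_mx_in _ _ _ (Ordinal iq) (Ordinal jp)) mxE.
  apply: eq_bigr => k _; rewrite !mxE -!addnA /=; congr (_ * _).
    by rewrite l.
  by rewrite addnA r.
Qed.

Definition subtract_count lo jlo i0 j0 i j : nat :=
  if [|| minn i j < lo + p, j < jlo
       | (j < jlo + p) && ((i < i0) || (i == i0) && (j < j0))]%N
  then (lo + p)%N else lo.

Lemma subtract_body_progress s lo jlo i j : ready s -> (lo + p <= q)%N ->
  (i < q)%N -> (jlo <= j < jlo + p)%N -> (jlo + p <= q)%N ->
  ireg s ri = i -> ireg s rj = j -> ireg s rhi = (lo + p)%N -> ireg s rjlo = jlo ->
  progress (fmem s) (subtract_count lo jlo i j) ->
  left_ready (fmem s) lo -> product_ready (fmem s) lo jlo ->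
  exists2 s', exec p subtract_body s (static_time subtract_body) 0 s'
    & [/\ progress (fmem s') (subtract_count lo jlo i j.+1), left_ready (fmem s') lo
        & product_ready (fmem s') lo jlo].
Proof.
move=> rs hiq iq j_in jhiq si sj sh sjl h l pr.
have [s' es' fs'] := subtract_body_exec rs iq si sj sh sjl.
have jq : (j < q)%N by lia.
have ij_lt := addr_lt iq jq.
exists s' => //; rewrite fs'; split.
- apply: (progress_upd h) => //.
    rewrite h // pr //; last by lia.
    have -> : (jlo + (j - jlo))%N = j by lia.
    (* In the trailing part [elim_block] turns the subtraction into [p] steps at once; elsewhere the
       factor is 0 and the panel has already done the work. *)
    have [/andP[hi_i hi_j]|N] := boolP ((lo + p <= i) && (lo + p <= j))%N.
      rewrite mulr1 /subtract_count ifF; last by lia.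
      by rewrite ifT; [rewrite (elim_block W (leqnn _) hi_i hi_j) | lia].
    rewrite mulr0 subr0 /subtract_count !ifT //; lia.
  move=> x y xq yq; rewrite xpair_eqE => ne; rewrite /subtract_count.
  by congr (minn (if _ then _ else _) _); lia.
- by apply: left_ready_upd_out; rewrite ?ij_lt.
- move=> x y xq yp; rewrite /upd ifF ?pr //.
  by apply/eqP => E; have := ij_lt; rewrite -E; lia.
Qed.

Lemma subtract_product_exec s lo jlo : ready s -> (lo + p <= q)%N -> (jlo + p <= q)%N ->
  ireg s rhi = (lo + p)%N -> ireg s rjlo = jlo -> ireg s rjhi = (jlo + p)%N ->
  progress (fmem s) (column_count lo (lo + p) jlo) ->
  left_ready (fmem s) lo -> product_ready (fmem s) lo jlo ->
  exists2 s', exec p subtract_product s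
      (for_time q (for_time p (static_time subtract_body))) 0 s'
    & progress (fmem s') (column_count lo (lo + p) (jlo + p)) /\ left_ready (fmem s') lo.
Proof.
move=> rs hiq jhiq sh sjl sjh h l pr.
have s0z s' : ready s' -> ireg s' rzero = 0%N by case=> -[].
have s0q s' : ready s' -> ireg s' rq = q by case=> -[].
have [|i s1 i_in si rs1 fr1 [h1 l1 p1]|s' es' [h' l' p']] := for_ready1 (i := ri)
  (lo := rzero) (hi := rq) (c := For rj rjlo rjhi rone subtract_body) (a := 0) (N := q)
  (t := for_time p (static_time subtract_body)) (k := 0)
  (Q := fun i fm => [/\ progress fm (subtract_count lo jlo i jlo),
     left_ready fm lo & product_ready fm lo jlo]) isT rs (s0z _ rs) (s0q _ rs).
- split=> //; apply: eq_progress h _ => i j iq jq.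
  rewrite /subtract_count /column_count.
  by congr (minn (if _ then _ else _) _); lia.
- have iq : (i < q)%N by lia.
  have [|||j s2 j_in sj rs2 fr2 [h2 l2 p2]|s' es' [h' l' p']] := for_ready1 (i := rj)
    (lo := rjlo) (hi := rjhi) (c := subtract_body) (a := jlo) (N := p)
    (t := static_time subtract_body) (k := 0)
    (Q := fun j fm => [/\ progress fm (subtract_count lo jlo i j),
       left_ready fm lo & product_ready fm lo jlo]) isT rs1.
  + by rewrite fr1.
  + by rewrite fr1.
  + by [].
  + by apply: subtract_body_progress; rewrite // fr2 // fr1.
  exists s'; first by rewrite muln0 in es'.
  split=> //; apply: (eq_progress h') => x y xq yq; rewrite /subtract_count.
  by congr (minn (if _ then _ else _) _); lia.
exists s'; first by rewrite muln0 in es'.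
split=> //; apply: (eq_progress h') => x y xq yq.
rewrite /subtract_count /column_count.
by congr (minn (if _ then _ else _) _); lia.
Qed.

Definition column_time : nat :=
  1 + (for_time p (for_time p (static_time right_body)) + (q * p +
       for_time q (for_time p (static_time subtract_body)))).

Lemma column_step_exec s lo jlo : ready s -> (lo + p <= q)%N -> (jlo + p <= q)%N ->
  ireg s rlo = lo -> ireg s rhi = (lo + p)%N -> ireg s rjlo = jlo ->
  progress (fmem s) (column_count lo (lo + p) jlo) -> left_ready (fmem s) lo ->
  exists2 s', exec p column_step s column_time 1 s'
    & progress (fmem s') (column_count lo (lo + p) (jlo + p)) /\ left_ready (fmem s') lo.
Proof.
move=> rs hiq jhiq sl sh sjl h l.
have [s1 [e1 m1 sjh1]] : exists s1, [/\ exec p (IAdd rjhi rjlo rp) s 1 0 s1,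
    fmem s1 = fmem s & ireg s1 rjhi = (jlo + p)%N].
  case: s rs sjl {h l sl sh} => c ir im fr fm [/= [_ sp _ _] _ _ _] sjl.
  eexists; split; first by apply: eval_exec => //=; reflexivity.
    by [].
  by rewrite /= /upd /= sjl sp.
have rs1 := exec_ready e1 rs isT; have [fr1 _] := exec_frame e1.
rewrite -m1 in h l.
have [|||s2 e2 [h2 l2 r2]] := @right_factor_exec s1 lo jlo rs1 hiq jhiq _ _ _ sjh1 h l.
- by rewrite fr1.
- by rewrite fr1.
- by rewrite fr1.
have rs2 := exec_ready e2 rs1 isT; have [fr2 _] := exec_frame e2.
have [s3 e3 [h3 l3 p3]] := tensor_exec rs2 h2 l2 r2.
have rs3 := exec_ready e3 rs2 isT; have [fr3 _] := exec_frame e3.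
have [|||s4 e4 [h4 l4]] := @subtract_product_exec s3 lo jlo rs3 hiq jhiq _ _ _ h3 l3 p3.
- by rewrite fr3 // fr2 // fr1.
- by rewrite fr3 // fr2 // fr1.
- by rewrite fr3 // fr2.
exists s4 => //; exact: (exec_seq e1 (exec_seq e2 (exec_seq e3 e4))).
Qed.

Definition block_time (N : nat) : nat :=
  1 + (for_time p (for_time p (for_time q (static_time panel_body))) +
       (for_time q (for_time p (static_time left_body)) + for_time N column_time)).

Lemma block_step_exec s lo N : ready s -> q = (N * p)%N -> (lo + p <= q)%N ->
  ireg s rlo = lo -> progress (fmem s) (fun _ _ => lo) ->
  exists2 s', exec p block_step s (block_time N) N s'
    & progress (fmem s') (fun _ _ => (lo + p)%N).
Proof.
move=> rs qE hiq sl h.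
have [s1 [e1 m1 sh1]] : exists s1, [/\ exec p (IAdd rhi rlo rp) s 1 0 s1,
    fmem s1 = fmem s & ireg s1 rhi = (lo + p)%N].
  case: s rs sl {h} => c ir im fr fm [/= [_ sp _ _] _ _ _] sl.
  eexists; split; first by apply: eval_exec => //=; reflexivity.
    by [].
  by rewrite /= /upd /= sl sp.
have rs1 := exec_ready e1 rs isT; have [fr1 _] := exec_frame e1.
rewrite -m1 in h; have sl1 : ireg s1 rlo = lo by rewrite fr1.
have [s2 e2 h2] := panel_exec rs1 hiq sl1 sh1 h.
have rs2 := exec_ready e2 rs1 isT; have [fr2 _] := exec_frame e2.
have sl2 : ireg s2 rlo = lo by rewrite fr2.
have sh2 : ireg s2 rhi = (lo + p)%N by rewrite fr2.
have [s3 e3 [h3 l3]] := left_factor_exec rs2 hiq sl2 sh2 h2.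
have rs3 := exec_ready e3 rs2 isT; have [fr3 _] := exec_frame e3.
have [|||||x s4 xN sj rs4 fr4 [h4 l4]|s' es' [h' l']] := for_ready (i := rjlo)
  (lo := rzero) (hi := rq) (d := rp) (c := column_step) (a := 0) (N := N) (e := p)
  (t := column_time) (k := 1)
  (Q := fun x fm => progress fm (column_count lo (lo + p) (x * p)) /\ left_ready fm lo)
  isT rs3.
- by case: rs3 => -[].
- by rewrite add0n -qE; case: rs3 => -[].
- by case: rs3 => -[].
- exact: p_gt0.
- split=> //; apply: eq_progress h3 _ => i j iq jq.
  by rewrite /block_count /column_count ltn0 orbF.
- rewrite mulSnr; apply: column_step_exec => //.
  + by rewrite qE -mulSnr leq_mul2r xN orbT.
  + by rewrite fr4 // fr3.
  + by rewrite fr4 // fr3.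
exists s'.
  rewrite muln1 in es'; exact: (exec_seq e1 (exec_seq e2 (exec_seq e3 es'))).
apply: (eq_progress h') => i j iq jq; rewrite /column_count -qE ifT //.
by rewrite jq orbT.
Qed.

Lemma main_loop_exec s N : ready s -> q = (N * p)%N ->
  progress (fmem s) (fun _ _ => 0%N) ->
  exists2 s', exec p (For rlo rzero rq rp block_step) s
      (for_time N (block_time N)) (N * N) s'
    & progress (fmem s') (fun _ _ => q).
Proof.
move=> rs qE h.
have [|||||x s1 xN sl rs1 fr h1|s' es' h'] := for_ready (i := rlo) (lo := rzero)
  (hi := rq) (d := rp) (c := block_step) (a := 0) (N := N) (e := p)
  (t := block_time N) (k := N)
  (Q := fun x fm => progress fm (fun _ _ => (x * p)%N)) isT rs.
- by case: rs => -[].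
- by rewrite add0n -qE; case: rs => -[].
- by case: rs => -[].
- exact: p_gt0.
- exact: h.
- rewrite mulSnr; apply: block_step_exec => //.
  by rewrite qE -mulSnr leq_mul2r xN orbT.
by exists s' => //; rewrite {2}qE.
Qed.

End Phases.

(** * Running time *)

Section Algorithm.
Variables (F : fieldType) (q p : nat).
Hypotheses (p_gt0 : 0 < p) (p_le_q : p <= q).
Implicit Types s : state F.

Lemma tables_exec s : ireg s rq = q -> ireg s rp = p -> ireg s rone = 1 ->
  ireg s rzero = 0 -> ireg s ru = 0 -> ireg s rv = 0 ->
  exists2 s', exec p tables s (for_time q 5) 0 s'
    & [/\ forall x, x < q -> imem s' x = x * q,
          forall x, x < q -> imem s' (q + x) = x * p,
          ireg s' ru = q * q, ireg s' rv = q * p & fmem s' = fmem s].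
Proof.
move=> sq sp s1 sz su sv.
have [| | |x s2 xq sx fr _ [i1 i2 u v m]|s' es' [i1 i2 u v m]] :=
  for_rule (i := rx) (lo := rzero) (hi := rq) (d := rone)
  (c := tables_body) (a := 0) (N := q) (e := 1)
  (p := p) (t := 5) (k := 0)
  (Q := fun x s' => [/\ forall y, y < x -> imem s' y = y * q,
          forall y, y < x -> imem s' (q + y) = y * p,
          ireg s' ru = x * q, ireg s' rv = x * p & fmem s' = fmem s]) isT sz _ s1 isT sz.
- by rewrite sq; lia.
- by move=> x s2 s3 [i1 i2 u v m] im fm fr; rewrite im fm !fr.
- by split.
- have {}sq : ireg s2 rq = q by rewrite fr.
  have {}sp : ireg s2 rp = p by rewrite fr.
  case: s2 sx fr i1 i2 u v m sq sp => c ir im fr0 fm /= sx _ i1 i2 u v m s2q s2p.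
  eexists; first by apply: eval_exec => //=; reflexivity.
  rewrite /= /upd /= sx u v s2q s2p; split=> //; try lia.
  (* The two tables do not collide, because [x < q] keeps the first one below address [q]. *)
  + move=> y; rewrite ltnS leq_eqVlt => yx.
    have -> : (y == q + (0 + x * 1)) = false by lia.
    case: eqP => [->|N]; first by lia.
    by apply: i1; lia.
  + move=> y; rewrite ltnS leq_eqVlt => yx.
    have -> : (q + y == q + (0 + x * 1)) = (y == x) by lia.
    case: eqP => [->|N]; first by lia.
    have -> : (q + y == 0 + x * 1) = false by lia.
    by apply: i2; lia.
by exists s' => //; rewrite muln0 in es'.
Qed.

Definition elimination_time (N : nat) : nat :=
  1 + (for_time q 5 + (1 + (1 + (1 + for_time N (block_time q p N))))).

Lemma blocked_elimination_exec N (c : 'M[F]_q) : q = N * p -> is_system c ->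
  exists2 s', exec p blocked_elimination (initial p c) (elimination_time N) (N * N) s'
    & read_mx (fmem s') 0 q q = forward_phase c.
Proof.
move=> qE sys_c; set s := initial p c.
(* Reading the reference matrix off the initial memory makes the invariant with count 0 hold by
   definition. *)
pose W i j := fmem s (i * q + j).
have [s1 [e1 m1 one1]] : exists s1, [/\ exec p (ISet rone 1) s 1 0 s1,
    fmem s1 = fmem s & ireg s1 rone = 1].
  by eexists; split; first by apply: eval_exec => //=; reflexivity.
have [fr1 _] := exec_frame e1.
have [|||||s2 e2 [i2 i2' u2 v2 m2]] := @tables_exec s1 _ _ one1;
  try by rewrite fr1.
have [fr2 _] := exec_frame e2.
have [s3 [e3 m3 r3]] : exists s3,
    [/\ exec p (IAdd rA ru rzero) s2 1 0 s3, fmem s3 = fmem s2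
      & [/\ ireg s3 rA = q * q, ireg s3 ru = q * q, ireg s3 rv = q * p
          & imem s3 = imem s2]].
  have z2 : ireg s2 rzero = 0 by rewrite fr2 // fr1.
  case: s2 {e2 i2 i2' m2 fr2} u2 v2 z2 => pc ir im fr fm /= u2 v2 z2.
  eexists; split; first by apply: eval_exec => //=; reflexivity.
    by [].
  by rewrite /= /upd /= u2 v2 z2 addn0.
have [fr3 _] := exec_frame e3.
case: r3 => a3 u3 v3 i3.
have [s4 [e4 m4 [b4 i4]]] : exists s4,
    [/\ exec p (IAdd rB ru rv) s3 1 0 s4, fmem s4 = fmem s3
      & ireg s4 rB = q * q + q * p /\ imem s4 = imem s3].
  case: s3 {e3 m3 fr3} a3 u3 v3 i3 => pc ir im fr fm /= a3 u3 v3 i3.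
  eexists; split; first by apply: eval_exec => //=; reflexivity.
    by [].
  by rewrite /= /upd /= u3 v3.
have [fr4 _] := exec_frame e4.
have [s5 [e5 m5 [c5 i5]]] : exists s5,
    [/\ exec p (IAdd rC rB rv) s4 1 0 s5, fmem s5 = fmem s4
      & ireg s5 rC = q * q + q * p + q * p /\ imem s5 = imem s4].
  have v4 : ireg s4 rv = q * p by rewrite fr4.
  case: s4 {e4 m4 fr4} b4 i4 v4 => pc ir im fr fm /= b4 i4 v4.
  eexists; split; first by apply: eval_exec => //=; reflexivity.
    by [].
  by rewrite /= /upd /= b4 v4.
have [fr5 _] := exec_frame e5.
have rs : ready q p s5.
  split; [split | split | by rewrite i5 i4 i3 | by rewrite i5 i4 i3] => //.
  - by rewrite fr5 // fr4 // fr3 // fr2 // fr1.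
  - by rewrite fr5 // fr4 // fr3 // fr2 // fr1.
  - by rewrite fr5 // fr4 // fr3 // fr2.
  - by rewrite fr5 // fr4 // fr3 // fr2 // fr1.
  - by rewrite fr5 // fr4.
  - by rewrite fr5.
have [s6 e6 h6] : exists2 s', exec p (For rlo rzero rq rp block_step) s5
      (for_time N (block_time q p N)) (N * N) s'
    & progress q W (fmem s') (fun _ _ => q).
  by apply: main_loop_exec => // i j iq jq; rewrite m5 m4 m3 m2 m1.
exists s6.
  have e456 := exec_seq e4 (exec_seq e5 e6).
  exact: (exec_seq e1 (exec_seq e2 (exec_seq e3 e456))).
apply/matrixP=> i j; rewrite mxE add0n h6 // (@forward_phase_elim _ _ _ W) //.
by move=> x y; rewrite /W /= -[x * q]add0n write_mx_in.
Qed.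

End Algorithm.

Lemma for_time_ge N t : N * t <= for_time N t.
Proof. by rewrite /for_time; lia. Qed.

(** The factor is 8 = 1 + 4 + 3: the body, the overhead of a round and that of the loop are each
    charged to [N * u >= 1]. *)
Lemma for_time_le N t u : 0 < N -> 0 < u -> t <= u -> for_time N t <= 8 * (N * u).
Proof.
move=> N0 u0 tu; rewrite /for_time mulnDr.
have : N * t <= N * u by rewrite leq_mul2l tu orbT.
have : N * 1 <= N * u by rewrite leq_mul2l u0 orbT.
lia.
Qed.

(** Only two contributions are kept: the operand size [q * p] of each of the [N * N] tensor calls,
    and one unit per innermost round of the [N] panels. *)
Lemma elimination_time_ge N p : 0 < p ->
  N * N * (N * p * p) + N * p * (N * p) * p <= elimination_time (N * p) p N.
Proof.
move=> p0; set q := N * p.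
rewrite /elimination_time.
have col : q * p <= column_time q p by rewrite /column_time; lia.
have blk : p * (p * q) + N * (q * p) <= block_time q p N.
  rewrite /block_time.
  have H1 : p * (p * q) <= for_time p (for_time p (for_time q (static_time panel_body))).
    apply: leq_trans (for_time_ge _ _); rewrite leq_mul2l; apply/orP; right.
    apply: leq_trans (for_time_ge _ _); rewrite leq_mul2l; apply/orP; right.
    by apply: leq_trans (for_time_ge _ _); rewrite leq_pmulr.
  have H2 : N * (q * p) <= for_time N (column_time q p).
    by apply: leq_trans (for_time_ge _ _); rewrite leq_mul2l col orbT.
  lia.
have : N * (p * (p * q) + N * (q * p)) <= for_time N (block_time q p N).
  by apply: leq_trans (for_time_ge _ _); rewrite leq_mul2l blk orbT.
have -> : N * (p * (p * q) + N * (q * p)) = N * N * (q * p) + q * q * p.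
  by rewrite /q; nia.
lia.
Qed.

(** The successor pays for the final [Halt]. The constants are rounded up from a factor 8 per nested
    loop times the lengths of the bodies, at most 10, 20, 20 and 60 instructions. *)
Lemma elimination_time_le N p : 0 < p -> 0 < N ->
  (elimination_time (N * p) p N).+1 <=
  500 * 1000 * (N * N * (N * p * p) + N * p * (N * p) * p).
Proof.
move=> p0 N0; set q := N * p.
have pq : p <= q by rewrite /q leq_pmull.
have q0 : 0 < q by lia.
have qp0 : 0 < q * p by rewrite muln_gt0 q0.
have ppqp : p * p <= q * p by rewrite leq_mul2r pq orbT.
have pp0 : 0 < p * p by rewrite muln_gt0 p0.
have two n a t u : 0 < n -> 0 < a -> 0 < u -> t <= u ->
    for_time n (for_time a t) <= 64 * (n * a * u).
  move=> n0 a0 u0 tu.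
  have au0 : 0 < 8 * (a * u) by rewrite !muln_gt0 a0 u0.
  apply: leq_trans (for_time_le n0 au0 (for_time_le a0 u0 tu)) _.
  by rewrite -(mulnA n a u); lia.
have col : column_time q p <= 2000 * (q * p).
  rewrite /column_time.
  have := two p p _ 10 p0 p0 isT (leqnn (static_time right_body)).
  have := two q p _ 20 q0 p0 isT (_ : static_time subtract_body <= 20) => /(_ isT).
  lia.
have col0 : 0 < 2000 * (q * p) by rewrite muln_gt0 qp0.
have lft := two q p _ 20 q0 p0 isT (_ : static_time left_body <= 20) => //.
have qppp : q * p <= p * p * q by rewrite (mulnC q) leq_mul2r leq_pmulr ?orbT.
have pnl : for_time p (for_time p (for_time q (static_time panel_body)))
    <= 40 * 1000 * (p * p * q).
  have q600 : 0 < 8 * (q * 60) by rewrite muln_gt0 /= muln_gt0 q0.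
  have H := for_time_le q0 (_ : 0 < 60) (_ : static_time panel_body <= 60).
  have := two p p _ _ p0 p0 q600 (H isT isT).
  by have := leq0n (p * p * q); lia.
have blk : block_time q p N <= 50 * 1000 * (p * p * q) + 20 * 1000 * (N * (q * p)).
  rewrite /block_time; have := for_time_le N0 col0 col.
  have := lft isT; have := leq0n (p * p * q); have := leq0n (N * (q * p)).
  lia.
have blk0 : 0 < 50 * 1000 * (p * p * q) + 20 * 1000 * (N * (q * p)).
  by rewrite addn_gt0 !muln_gt0 p0 N0.
have := for_time_le N0 blk0 blk.
have tab := for_time_le q0 (_ : 0 < 5) (leqnn 5).
have {}tab := tab isT.
have E1 : N * (p * p * q) = q * q * p by rewrite /q; nia.
have E2 : N * (N * (q * p)) = N * N * (q * p) by rewrite mulnA.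
rewrite /elimination_time mulnDr (mulnCA N (50 * 1000)) (mulnCA N (20 * 1000)) E1 E2.
have q1 : q <= q * q * p by rewrite -mulnA leq_pmulr // muln_gt0 q0.
have := leq0n (q * q * p); have := leq0n (N * N * (q * p)).
lia.
Qed.

(** * The final program and the two bounds *)

Definition forward_program : program := rcons (compile 0 blocked_elimination) Halt.

Local Open Scope ring_scope.

Theorem theorem4 (R : rcfType) (F : fieldType) :
  exists (P : program) (a b a' b' : R),
    [/\ 0 < a, 0 < b, 0 < a' & 0 < b'] /\
    forall (n m q p : nat) (l : R) (c : 'M[F]_q),
      (0 < n)%N -> (0 < m)%N -> n = (q ^ 2)%N -> m = (p ^ 2)%N -> (m %| n)%N ->
      0 <= l -> is_system c -> pivots_nonzero c ->
      exists t : R,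
        [/\ performs_forward_phase P p l c t,
            let g := Num.sqrt (n%:R ^+ 3) / Num.sqrt m%:R + n%:R / m%:R * l
                     + n%:R * Num.sqrt m%:R in
            a * g <= t <= b * g
          & m%:R <= Num.sqrt n%:R :> R ->
            let g := Num.sqrt (n%:R ^+ 3) / Num.sqrt m%:R + n%:R / m%:R * l in
            a' * g <= t <= b' * g].
Proof.
pose K : R := (500 * 1000)%:R.
have K1 : (1 <= K) by rewrite ler1n.
(* The lower constants are 1, since [elimination_time_ge] has no loss and the latency term is exact.
   In the second upper bound the factor 2 pays for the absorbed term [n sqrt m]. *)
exists forward_program, 1, K, 1, (2 * K).
split; first by split; lra.
move=> n m q p l c n0 m0 nE mE mn l0 sys_c _.
have p0 : (0 < p)%N by move: m0; rewrite mE expn_gt0 orbF.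
have q0 : (0 < q)%N by move: n0; rewrite nE expn_gt0 orbF.
(* Divisibility of the squares gives that of the sides, so the matrix splits into whole blocks. *)
have /dvdnP[N qE] : (p %| q)%N by rewrite -(@dvdn_pexp2r _ _ 2) // -nE -mE.
have N0 : (0 < N)%N by move: q0; rewrite qE muln_gt0 => /andP[].
have pq : (p <= q)%N by rewrite qE leq_pmull.
have [s' es' rs'] := blocked_elimination_exec p0 pq qE sys_c.
set T := elimination_time q p N in es'.
have le_T : (N * N * (q * p) + q * q * p <= T)%N
  by rewrite /T qE elimination_time_ge.
have ge_T : (T.+1 <= 500 * 1000 * (N * N * (q * p) + q * q * p))%N.
  by rewrite /T qE elimination_time_le.
exists (total_time l T (N * N)%N + 1).
have sqrt_nat k : Num.sqrt ((k ^ 2)%:R : R) = k%:R.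
  by rewrite natrX sqrtr_sqr normr_nat.
have pR0 : (p%:R != 0 :> R) by rewrite pnatr_eq0 -lt0n.
have E1 : (Num.sqrt (n%:R ^+ 3) / Num.sqrt m%:R = (N * N * (q * p))%:R :> R).
  rewrite -natrX nE mE -expnM -[(2 * 3)%N]/(3 * 2)%N expnM !sqrt_nat qE.
  by rewrite natrX !natrM; field.
have E2 : (n%:R / m%:R = (N * N)%:R :> R).
  by rewrite nE mE qE !natrX !natrM; field.
have E3 : (n%:R * Num.sqrt m%:R = (q * q * p)%:R :> R).
  by rewrite nE mE sqrt_nat natrX !natrM expr2.
rewrite E1 E2 E3 /total_time.
move: le_T; rewrite -(ler_nat R) natrD => le_T.
move: ge_T; rewrite -(ler_nat R) -addn1 natrD natrM natrD -/K => ge_T.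
clearbody K.
have Nl0 : (0 <= (N * N)%:R * l) by rewrite mulr_ge0.
split.
- exists (set_pc (csize blocked_elimination) s') => //.
  have code : code_at forward_program 0 (compile 0 blocked_elimination).
    by exists [::], [:: Halt]; rewrite /forward_program -cats1.
  apply: (exec_run es' code); exact: run_halt.
- set A := ((N * N * _)%:R) in le_T ge_T *.
  set B := ((q * q * p)%:R) in le_T ge_T *; set L := (_ * l) in Nl0 *.
  have : (L <= K * L) by rewrite ler_peMl.
  by rewrite mul1r !mulrDr; move: ge_T; rewrite mulrDr; lra.
- rewrite mE nE sqrt_nat ler_nat => pq2.
  (* The condition [m <= sqrt n] reads [p ^ 2 <= N * p]; with [p <= N], the panel term [q * q * p]
     is at most the tensor term [N * N * (q * p)]. *)
  have pN : (p <= N)%N by move: pq2; rewrite qE expnS expn1 leq_pmul2r.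
  have : (q * q * p <= N * N * (q * p))%N.
    by rewrite -mulnA leq_mul2r qE leq_mul2l pN !orbT.
  rewrite -(ler_nat R); set A := ((N * N * _)%:R) in le_T ge_T *.
  set B := ((q * q * p)%:R) in le_T ge_T *; set L := (_ * l) in Nl0 *.
  move=> BA; have B0 : (0 <= B) by rewrite ler0n.
  have : (L <= K * L) by rewrite ler_peMl.
  have : (K * B <= K * A) by rewrite ler_wpM2l //; lra.
  by move: ge_T; rewrite mul1r !mulrDr; lra.
Qed.
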